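(* Let $X$ be a Tychonoff space containing an infinite compact set and let $E$ be a Fréchet space which is not a Montel space. Then $C_p(X,E)$ contains a complemented copy of $(c_0)_p$.
   Context: Spaces are over $\mathbb{R}$. A Fréchet space is a complete metrisable locally convex space. $C_p(X,E)$ is the space of all continuous functions $X\to E$ with the pointwise topology (inherited from the product $E^X$). Tychonoff means completely regular and Hausdorff. $(c_0)_p=\{x\in\mathbb{R}^\omega: x(n)\to 0\}$ with the topology inherited from the product $\mathbb{R}^\omega$. A locally convex space $G$ contains a complemented copy of $F$ if there are closed linear subspaces $G_1,G_2$ of $G$ with $G=G_1\oplus G_2$ algebraically, $G_1$ linearly homeomorphic to $F$, and the natural projection of $G$ onto $G_1$ continuous. *)

(* Defs.v *)
From HB Require Import structures.
From mathcomp Require Import all_boot all_order all_algebra.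
From mathcomp Require Import all_classical all_reals all_analysis.

Set Implicit Arguments.
Unset Strict Implicit.
Unset Printing Implicit Defensive.

Import Order.TTheory GRing.Theory Num.Theory.
Import numFieldNormedType.Exports.

Local Open Scope classical_set_scope.
Local Open Scope ring_scope.

Section topological_vector_spaces.
Context {R : realType}.

Definition metrizable (T : topologicalType) :=
  exists d : T -> T -> R,
    [/\ forall x y, (d x y = 0) <-> (x = y),
        forall x y, d x y = d y x,
        forall y x z, d x z <= d x y + d y z &
        forall x (A : set T),
          nbhs x A <-> exists2 e, 0 < e & [set y | d x y < e] `<=` A].

(* The entourages of a tvsType are only required to induce its topology: they
   need not be those of the additive group. Completeness of a topological
   vector space refers to the latter, whence these definitions in terms of
   neighborhoods of 0 instead of cauchy and completeType. *)
Definition tvs_cauchy (E : tvsType R) (F : set_system E) :=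
  forall U : set E, nbhs 0 U ->
    exists2 A, F A & forall x y, A x -> A y -> U (x - y).

Definition tvs_complete (E : tvsType R) :=
  forall F : set_system E, ProperFilter F -> tvs_cauchy F ->
    exists x : E, F --> x.

Definition frechet_space (E : tvsType R) := metrizable E /\ tvs_complete E.

Definition absorbs (E : lmodType R) (U B : set E) :=
  exists2 r : R, 0 < r & forall t : R, r <= `|t| -> B `<=` *:%R t @` U.

(* bounded_set is reserved by the library for normed spaces. *)
Definition tvs_bounded (E : tvsType R) (B : set E) :=
  forall U : set E, nbhs 0 U -> absorbs U B.

Definition balanced (E : lmodType R) (A : set E) :=
  forall t : R, `|t| <= 1 -> *:%R t @` A `<=` A.

Definition barrel (E : tvsType R) (A : set E) :=
  [/\ closed A, convex_set A, balanced A & forall x, absorbs A [set x]].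

Definition barrelled (E : tvsType R) :=
  forall A : set E, barrel A -> nbhs 0 A.

Definition montel_space (E : tvsType R) :=
  [/\ hausdorff_space E, barrelled E &
      forall B : set E, closed B -> tvs_bounded B -> compact B].

Definition linear_homeomorphic_to (F G : tvsType R) (G1 : set G) :=
  exists (T : {linear F -> G}) (S : G -> F),
    [/\ range T = G1, cancel T S, continuous T & {within G1, continuous S}].

Definition contains_complemented_copy (G F : tvsType R) :=
  exists G1 G2 : set G,
    [/\ submod_closed [in G1] /\ submod_closed [in G2],
        closed G1 /\ closed G2,
        forall g : G, exists! p : G * G, [/\ G1 p.1, G2 p.2 & g = p.1 + p.2],
        linear_homeomorphic_to F G1 &
        exists2 P : G -> G,
          forall x y, G1 x -> G2 y -> P (x + y) = x & continuous P].

End topological_vector_spaces.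

Definition tychonoff_space (T : topologicalType) :=
  completely_regular_space T /\ hausdorff_space T.

(* W embeds linearly in X -> E through ev, and cvgW says that its topology is
   the one induced by the product topology. *)
Section pointwise_tvs.
Context {R : realType} (X : topologicalType) (E : tvsType R).
Context (W : preTopologicalLmodType R) (ev : W -> X -> E).
Hypothesis evD : forall f g t, ev (f + g) t = ev f t + ev g t.
Hypothesis evZ : forall a f t, ev (a *: f) t = a *: ev f t.
Hypothesis cvgW : forall (F : set_system W) (f : W), Filter F ->
  F --> f <-> forall t, ev ^~ t @ F --> ev f t.

Let ev_continuous t : continuous (ev ^~ t).
Proof.
by move=> f; exact: (iffLR (@cvgW (nbhs f) f _) cvg_id).
Qed.

Lemma pointwise_add_continuous : continuous (fun x : W * W => x.1 + x.2).
Proof.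
move=> [f g]; apply: (iffRL (@cvgW ((fun x => x.1 + x.2) @ nbhs (f, g))
  (f + g) _)) => t.
have -> : ev (f + g) t = ev f t + ev g t by rewrite evD.
rewrite -(@eq_cvg _ _ _ (fun x : W * W => ev x.1 t + ev x.2 t)); last first.
  by move=> x /=; rewrite evD.
apply: (@continuous2_cvg _ _ _ _ _ _ (fun x : W * W => ev x.1 t)
  (fun x : W * W => ev x.2 t) (fun a b : E => a + b)).
- exact: (@add_continuous E (ev f t, ev g t)).
- exact: (@cvg_comp _ _ _ fst (ev ^~ t) _ _ _ cvg_fst (@ev_continuous t _)).
- exact: (@cvg_comp _ _ _ snd (ev ^~ t) _ _ _ cvg_snd (@ev_continuous t _)).
Qed.

Lemma pointwise_scale_continuous :
  continuous (fun z : R^o * W => z.1 *: z.2).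
Proof.
move=> [a f]; apply: (iffRL (@cvgW ((fun z : R^o * W => z.1 *: z.2) @ nbhs (a, f))
  (a *: f) _)) => t.
have -> : ev (a *: f) t = a *: ev f t by rewrite evZ.
rewrite -(@eq_cvg _ _ _ (fun z : R^o * W => z.1 *: ev z.2 t)); last first.
  by move=> z /=; rewrite evZ.
apply: (@continuous2_cvg _ _ _ _ _ _ (fun z : R^o * W => z.1)
  (fun z : R^o * W => ev z.2 t) (fun (b : R^o) (x : E) => b *: x)).
- exact: (@scale_continuous R E (a, ev f t)).
- exact: cvg_fst.
- exact: (@cvg_comp _ _ _ snd (ev ^~ t) _ _ _ cvg_snd (@ev_continuous t _)).
Qed.

Lemma pointwise_locally_convex :
  exists2 B : set_system W, (forall b, b \in B -> convex_set b) & basis B.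
Proof.
pose B : set_system W := [set U | open U /\ convex_set U].
exists B; first by move=> b /set_mem[].
split=> [b []//|f].
have BF : Filter (filter_from [set U | B U /\ U f] id).
  apply: filter_from_filter.
    exists setT; split=> //; split; first exact: openT.
    by move=> x y l _ _; rewrite in_setT.
  move=> U V [[oU cU] Uf] [[oV cV] Vf]; exists (U `&` V) => //.
  split=> //; split; first exact: openI.
  move=> x y l /set_mem[Ux Vx] /set_mem[Uy Vy]; apply/mem_set; split.
    by apply/set_mem/cU; exact/mem_set.
  by apply/set_mem/cV; exact/mem_set.
apply: (iffRL (@cvgW _ f BF)) => t A /=.
have [C cC [oC +]] := @locally_convex R E.
move=> /(_ (ev f t) A) /[apply] -[U [CU Uf] UA].
exists (ev ^~ t @^-1` U); last by move=> g /UA.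
split=> //; split.
  apply: open_comp => [? _|]; [exact: ev_continuous|exact: oC].
move=> x y l /set_mem Ux /set_mem Uy; apply/mem_set => /=.
rewrite /conv /= evD !evZ.
by apply/set_mem/(cC U); exact/mem_set.
Qed.

End pointwise_tvs.

Section sub_function_space.
Context {R : realType} (X : topologicalType) (E : tvsType R).
Context (A : set (X -> E)).

Lemma initial_ptws_cvgP
    (F : set_system (initial_topology (set_val : A -> {ptws X -> E})))
    (f : initial_topology (set_val : A -> {ptws X -> E})) : Filter F ->
  F --> f <-> forall t, (fun g : A => set_val g t) @ F --> set_val f t.
Proof.
move=> FF; transitivity ({ptws, set_val @ F --> (set_val f : X -> E)}).
  split=> [Ff|Ff U].
    apply: cvg_trans; first exact: (cvg_app _ Ff).
    exact: (@initial_continuous A {ptws X -> E} set_val).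
  rewrite nbhsE => -[V [[V' oV' <-] V'f] VU].
  by apply: (filterS VU); apply: Ff; exact: open_nbhs_nbhs.
exact: pointwise_cvgP.
Qed.

End sub_function_space.

Section Cp.
Context {R : realType} (X : topologicalType) (E : tvsType R).

Definition Cp := set_type [set f : X -> E | continuous f].

HB.instance Definition _ := SubChoice.on Cp.

Lemma Cp_submod_closed :
  submod_closed [in [set f : X -> E | continuous f]].
Proof.
split=> [|a f g]; rewrite !inE /=; first exact: cst_continuous.
move=> cf cg x.
apply: (@continuous2_cvg _ _ _ _ _ _ (fun y => a *: f y) g
   (fun u v : E => u + v)).
- exact: (@add_continuous E (a *: f x, g x)).
- apply: (@continuous2_cvg _ _ _ _ _ _ (cst (a : R^o)) f
    (fun (b : R^o) (u : E) => b *: u)).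
  + exact: (@scale_continuous R E (a, f x)).
  + exact: cvg_cst.
  + exact: cf.
- exact: cg.
Qed.

HB.instance Definition _ := GRing.SubChoice_isSubLmodule.Build R _ _ Cp
  (GRing.submod_closed_semi Cp_submod_closed).

HB.instance Definition _ := Topological.copy Cp
  (initial_topology (set_val : Cp -> {ptws X -> E})).

Let evD (f g : Cp) t : set_val (f + g) t = set_val f t + set_val g t.
Proof. by []. Qed.

Let evZ a (f : Cp) t : set_val (a *: f) t = a *: set_val f t.
Proof. by []. Qed.

Let cvgE (F : set_system Cp) (f : Cp) : Filter F ->
  F --> f <-> forall t, (fun g : Cp => set_val g t) @ F --> set_val f t.
Proof. exact: initial_ptws_cvgP. Qed.

(* PreTopologicalLmod_isTvs only provides the additive uniformity. *)
HB.instance Definition _ := PreTopologicalLmod_isTvs.Build R Cp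
  (pointwise_add_continuous evD cvgE)
  (pointwise_scale_continuous evZ cvgE)
  (pointwise_locally_convex evD evZ cvgE).
HB.instance Definition _ := PreTopologicalNmodule_isTopologicalNmodule.Build Cp
  (pointwise_add_continuous evD cvgE).
HB.instance Definition _ := TopologicalNmodule_isTopologicalLmodule.Build R Cp
  (pointwise_scale_continuous evZ cvgE).
HB.instance Definition _ := Uniform_isTvs.Build R Cp
  (pointwise_locally_convex evD evZ cvgE).

End Cp.

Section c0p.
Context (R : realType).

Definition c0p := set_type [set x : nat -> R^o | x n @[n --> \oo] --> (0 : R^o)].

HB.instance Definition _ := SubChoice.on c0p.

Lemma c0p_submod_closed :
  submod_closed [in [set x : nat -> R^o | x n @[n --> \oo] --> (0 : R^o)]].
Proof.
split=> [|a x y]; rewrite !inE /=; first exact: cvg_cst.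
move=> x0 y0; rewrite -[X in _ --> X]addr0 -[X in _ --> X + _](scaler0 _ a).
by apply: cvgD => //; exact: cvgZr.
Qed.

HB.instance Definition _ := GRing.SubChoice_isSubLmodule.Build R _ _ c0p
  (GRing.submod_closed_semi c0p_submod_closed).

HB.instance Definition _ := Topological.copy c0p
  (initial_topology (set_val : c0p -> {ptws nat -> R^o})).

Let evD (x y : c0p) t : set_val (x + y) t = set_val x t + set_val y t.
Proof. by []. Qed.

Let evZ a (x : c0p) t : set_val (a *: x) t = a *: set_val x t.
Proof. by []. Qed.

Let cvgE (F : set_system c0p) (x : c0p) : Filter F ->
  F --> x <-> forall t, (fun y : c0p => set_val y t) @ F --> set_val x t.
Proof. exact: initial_ptws_cvgP. Qed.

HB.instance Definition _ := PreTopologicalLmod_isTvs.Build R c0p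
  (pointwise_add_continuous evD cvgE)
  (pointwise_scale_continuous evZ cvgE)
  (pointwise_locally_convex evD evZ cvgE).
HB.instance Definition _ := PreTopologicalNmodule_isTopologicalNmodule.Build c0p
  (pointwise_add_continuous evD cvgE).
HB.instance Definition _ := TopologicalNmodule_isTopologicalLmodule.Build R c0p
  (pointwise_scale_continuous evZ cvgE).
HB.instance Definition _ := Uniform_isTvs.Build R c0p
  (pointwise_locally_convex evD evZ cvgE).

End c0p.

(* Main.v *)
Require Import Defs.
From HB Require Import structures.
From mathcomp Require Import all_boot all_order all_algebra.
From mathcomp Require Import all_classical all_reals all_analysis.
From mathcomp Require Import ring lra zify.

Set Implicit Arguments.
Unset Strict Implicit.
Unset Printing Implicit Defensive.

Import Order.TTheory GRing.Theory Num.Theory.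
Import numFieldNormedType.Exports.

Local Open Scope classical_set_scope.
Local Open Scope ring_scope.

(** Let K be an infinite compact subset of X.  Complete regularity gives points
    t_p of K and bump functions phi_p with pairwise disjoint supports and
    phi_p(t_p) = 1 (disjoint_bumps); index them by pairs p = (n, i).  Suppose
    that E carries finite families of functionals h_(n,i), i < l_n, all bounded
    by 1 on one neighborhood U of 0, and vectors w_(n,i), uniformly bounded for
    large n, such that
      h_(n,i)(w_(n,i)) = 1   and   (1/l_n) sum_i |h_(n,i)(x)| --> 0 for every x.
    (This is null_system.)  Then
      Q(g)(n) = (1/l_n) sum_i h_(n,i)(g(t_(n,i)))   and
      T(a) = sum_(n,i) a_n phi_(n,i) w_(n,i)
    are continuous linear maps between C_p(X,E) and (c_0)_p with Q T = id, so
    that T Q projects onto a copy of (c_0)_p.  Here Q(g) tends to 0 because g(K)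
    is covered by finitely many small translates of U, and T(a) is a continuous
    function because the a_n w_(n,i) tend to 0 while at most one bump is active
    at each point.

    It remains to build a null system in a Frechet space that is not Montel.
    With l_n = 1 this would be a theorem of Josefson-Nissenzweig type (a weak*
    null sequence of functionals that is not uniformly null on bounded sets);
    averaging over finite families makes it much more elementary.

    A Frechet space is barrelled by the Baire argument, hence a non-Montel one
    has a closed bounded set that is not compact, and by completeness not
    totally bounded.  Schauder's argument on the precompactness of adjoints,
    with Hahn-Banach separation and a pigeonhole, turns this into a sequence f_n
    in the polar of U and a bounded sequence z_n with f_n(z_n) - f_k(z_n) >= 1/2
    for k < n (not_montel_polar).  Let V_j be a countable base at 0; for a
    finite list s of integers consider the slab W_s of those x in U that lie in
    (s_j + 1) V_j for all j < size s, and the samples (f_i x)_(i<n), measured by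
    the normalized l^2 norm of R^n.  There are two cases.

    - For some c > 0 and some sequence lambda, every slab W_(lambda|k) contains
      arbitrarily many points whose samples are c-separated, for suitable n.  A
      pigeonhole on inner products gives among their differences N almost
      orthogonal samples of norm at least c.  The functionals
      y |-> <u_k, y>, where u_k runs over these differences, then have average
      O(N^(-1/2)) by a Bessel inequality, while <u_k, u_k> >= c^2; as the N-th
      family is taken in W_(lambda|N), the vectors stay bounded
      (null_system_orthogonal).

    - Otherwise, for all c and lambda, some W_(lambda|k) has c-nets for its
      samples whose size does not depend on n.  There are countably many slabs
      and countably many c = 1/(m+1).  For the first r of these pairs colour the
      indices with finitely many colours, so that up to a small error in the mean
      f_i x depends on the colour of i only, for all x in the slab.  Pairing many
      indices of equal colour yields differences f_j - f_i that are small in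
      the mean at these x, yet at least 1/2 at z_j.  Every x in U lies in all the
      slabs of some branch lambda, so it is reached for every c
      (null_system_matching). *)

(** * Absolutely convex neighborhoods *)

Section abs_convex.
Context {R : realType} {E : lmodType R}.
Implicit Types (A : set E) (x y : E).

Definition abs_convex A := forall x y a b,
  A x -> A y -> `|a| + `|b| <= 1 -> A (a *: x + b *: y).

Lemma convex_setP A x y (l : R) : convex_set A -> A x -> A y ->
  0 <= l -> l <= 1 -> A (l *: x + (1 - l) *: y).
Proof.
move=> cA /mem_set Ax /mem_set Ay l0 l1.
exact: (set_mem (cA x y (Itv01 l0 l1) Ax Ay)).
Qed.

Lemma abs_convex_balanced A x a : abs_convex A -> A x -> `|a| <= 1 -> A (a *: x).
Proof.
move=> cA Ax a1; rewrite -[a *: x]addr0 -(scale0r x).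
by apply: cA => //; rewrite normr0 addr0.
Qed.

Lemma abs_convexN A x : abs_convex A -> A x -> A (- x).
Proof.
by move=> cA Ax; rewrite -scaleN1r; apply: abs_convex_balanced; rewrite // normrN normr1.
Qed.

End abs_convex.

Section nbhs0.
Context {R : realType} {E : tvsType R}.
Implicit Types (A : set E).

(** A convex neighborhood met with its opposite: scalars are then replaced by
    their absolute values, and 0 absorbs what is missing to total weight 1. *)
Lemma nbhs0_abs_convex A : nbhs 0 A ->
  exists V : set E, [/\ nbhs 0 V, abs_convex V & V `<=` A].
Proof.
have [C cC [oC +]] := @locally_convex R E.
move=> /(_ 0 A) /[apply] -[U [CU U0] UA].
have nU : nbhs 0 U by apply: open_nbhs_nbhs; split => //; exact: oC.
have cU : convex_set U by apply: cC; exact/mem_set.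
exists (U `&` (-%R @` U)); split.
- by apply: filterI => //; exact: nbhs0N.
- have H (D : set E) : convex_set D -> D 0 -> forall x y a b, 0 <= a -> 0 <= b ->
     a + b <= 1 -> D x -> D y -> D (a *: x + b *: y).
    move=> cD D0 x y a b a0 b0 ab Dx Dy.
    have [s0|s0] := eqVneq (a + b) 0.
      have -> : a = 0 by lra.
      have -> : b = 0 by lra.
      by rewrite !scale0r addr0.
    have sp : 0 < a + b by rewrite lt_neqAle eq_sym s0 addr_ge0.
    have -> : a *: x + b *: y = (a + b) *: ((a / (a + b)) *: x + (1 - a / (a + b)) *: y)
        + (1 - (a + b)) *: 0.
      rewrite scaler0 addr0 scalerDr !scalerA; congr (_ *: _ + _ *: _); by field.
    apply: convex_setP => //; last exact: addr_ge0.
    apply: convex_setP => //; first by rewrite divr_ge0 // ltW.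
    by rewrite ler_pdivrMr// mul1r; lra.
  have cNU : convex_set (-%R @` U).
    move=> x y l /set_mem[x' Ux' <-] /set_mem[y' Uy' <-]; apply/mem_set.
    exists (l%:num *: x' + (1 - l%:num) *: y'); first exact: convex_setP.
    by rewrite opprD -!scalerN.
  move=> x y a b Vx Vy ab.
  have N z : (U `&` -%R @` U) z -> (U `&` -%R @` U) (- z).
    by move=> [Uz [w Uw wz]]; split; [rewrite -wz opprK|exists z].
  have S c z : (U `&` -%R @` U) z -> exists2 z', (U `&` -%R @` U) z' & c *: z = `|c| *: z'.
    move=> Vz; have [c0|c0] := ler0P c.
      by exists (- z); [exact: N|rewrite scalerN scaleNr opprK].
    by exists z.
  have [x' [Ux' Nx'] ->] := S a _ Vx; have [y' [Uy' Ny'] ->] := S b _ Vy.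
  by split; apply: H => //; exists 0; rewrite ?oppr0.
- exact: subset_trans UA.
Qed.

Lemma nbhs0_absorbs A x : nbhs 0 A -> exists2 r : R, 0 < r & A (r^-1 *: x).
Proof.
move=> nA.
have : (fun t : R => t *: x) @ (0 : R) --> (0 : E).
  rewrite -[X in _ --> X](scale0r x).
  apply: (@continuous2_cvg _ _ _ _ (nbhs (0 : R)) _ (fun t : R => t : R^o) (cst x)
    (fun (t : R^o) (y : E) => t *: y)).
  - exact: (@scale_continuous R E (0, x)).
  - exact: cvg_id.
  - exact: cvg_cst.
move=> /(_ A nA) /nbhs_ballP[e /= e0 He].
exists (2 / e); first by rewrite divr_gt0.
apply: He; rewrite /ball/= sub0r normrN invf_div ger0_norm ?divr_ge0 ?ltW//.
by rewrite ltr_pdivrMr//; lra.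
Qed.

Lemma nbhs0_half A : nbhs 0 A -> exists V : set E,
  [/\ nbhs 0 V, abs_convex V & forall x y, V x -> V y -> A (x + y)].
Proof.
move=> /nbhs0_abs_convex[V [nV cV VA]].
have h0 : (2^-1 : R) != 0 by rewrite invr_eq0.
exists ( *:%R (2^-1) @` V); split.
- exact: nbhs0Z.
- move=> _ _ a b [x Vx <-] [y Vy <-] ab; exists (a *: x + b *: y); first exact: cV.
  by rewrite scalerDr !scalerA ![_^-1 * _]mulrC.
- move=> _ _ [x Vx <-] [y Vy <-]; apply: VA; apply: cV => //.
  by rewrite ger0_norm ?invr_ge0//; lra.
Qed.

Lemma nbhs0_shift A x : nbhs 0 A -> nbhs x [set y | A (y - x)].
Proof.
move=> nA; have := nbhsT x nA; congr (nbhs _ _).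
apply/seteqP; split => [_ [y Ay <-]/=|y Ay]; first by rewrite addrC addKr.
by exists (y - x) => //; rewrite addrC subrK.
Qed.

Lemma nbhs_shift0 A x : nbhs x A -> nbhs 0 [set y | A (x + y)].
Proof.
move=> nA; have := nbhsB (- x) nA; rewrite addNr; congr (nbhs _ _).
apply/seteqP; split => [_ [y Ay <-]/=|y Ay]; first by rewrite addNKr.
by exists (x + y) => //; rewrite addKr.
Qed.

End nbhs0.

(** * Hahn-Banach separation *)

Section hahn_banach.
Context {R : realType} {E : lmodType R}.
Implicit Types (q : E -> R) (x y : E).

Definition sublinear q := (forall x y, q (x + y) <= q x + q y) /\
  (forall t x, 0 <= t -> q (t *: x) = t * q x).

Lemma sublinearW q : (forall x y, q (x + y) <= q x + q y) ->
  (forall t x, 0 < t -> q (t *: x) <= t * q x) -> q 0 = 0 -> sublinear q.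
Proof.
move=> qD qZ q0; split => // t x; rewrite le_eqVlt => /predU1P[<-|t0].
  by rewrite scale0r mul0r.
apply/eqP; rewrite eq_le qZ//= mulrC -ler_pdivlMr// mulrC.
have {1}-> : x = t^-1 *: (t *: x) by rewrite scalerA mulVf ?scale1r// gt_eqF.
by apply: qZ; rewrite invr_gt0.
Qed.

Lemma sublinear0 q : sublinear q -> q 0 = 0.
Proof. by move=> [_ qZ]; rewrite -(scale0r 0) qZ// mul0r. Qed.

Lemma sublinearN q x : sublinear q -> - q (- x) <= q x.
Proof.
move=> sq; have := sq.1 x (- x); rewrite subrr sublinear0//; lra.
Qed.

(** The largest sublinear functional below q that takes the value - q a at - a.
    Tilting is how a sublinear functional is lowered: one that tilting leaves
    unchanged in every direction is linear. *)
Definition tilt q a x := inf [set q (x + t *: a) - t * q a | t in [set t : R | 0 <= t]].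

Lemma tilt_le q a x t : sublinear q -> 0 <= t -> tilt q a x <= q (x + t *: a) - t * q a.
Proof.
move=> sq t0; apply: ge_inf; last by exists t.
exists (- q (- x)) => _ [s s0 <-].
have := sq.1 (x + s *: a) (- x); rewrite addrC addKr sq.2//; lra.
Qed.

Lemma le_tilt q a x r : (forall t, 0 <= t -> r <= q (x + t *: a) - t * q a) ->
  r <= tilt q a x.
Proof.
move=> H; apply: lb_le_inf; first by exists (q (x + 0 *: a) - 0 * q a), 0 => /=.
by move=> _ [t t0 <-]; exact: H.
Qed.

Lemma tilt_sublinear q a : sublinear q -> sublinear (tilt q a).
Proof.
move=> sq; apply: sublinearW.
- move=> x y; rewrite -lerBlDr; apply: le_tilt => s s0.
  rewrite lerBlDr [leRHS]addrC -lerBlDr; apply: le_tilt => t t0.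
  have := @tilt_le q a (x + y) (s + t) sq (addr_ge0 s0 t0).
  have := sq.1 (x + s *: a) (y + t *: a).
  by rewrite addrACA -scalerDl; lra.
- move=> t x t0; rewrite mulrC -ler_pdivrMr//; apply: le_tilt => s s0.
  rewrite ler_pdivrMr//.
  have := @tilt_le q a (t *: x) (s * t) sq (mulr_ge0 s0 (ltW t0)).
  have -> : t *: x + (s * t) *: a = t *: (x + s *: a).
    by rewrite scalerDr scalerA [t * s]mulrC.
  rewrite sq.2 ?(ltW t0)// => /le_trans; apply.
  by rewrite [leRHS](_ : _ = t * q (x + s *: a) - s * t * q a) //; ring.
- apply/eqP; rewrite eq_le; apply/andP; split.
    by have := @tilt_le q a 0 0 sq (lexx _); rewrite scale0r addr0 mul0r subr0 (sublinear0 sq).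
  by apply: le_tilt => t t0; rewrite add0r sq.2// subrr.
Qed.

Lemma tilt_id q a x : sublinear q -> tilt q a x <= q x.
Proof.
move=> sq; have := @tilt_le q a x 0 sq (lexx _).
by rewrite scale0r addr0 mul0r subr0.
Qed.

(** Zorn's lemma on all sublinear functionals below q0, rather than on partially
    defined linear ones: the infimum of a chain is sublinear, and it is finite
    because - q0 (- x) is a lower bound. *)
Lemma minimal_sublinear q0 : sublinear q0 -> exists q, [/\ sublinear q,
  forall x, q x <= q0 x & forall q', sublinear q' -> (forall x, q' x <= q x) -> q' = q].
Proof.
move=> sq0; pose T := {q : E -> R | sublinear q /\ forall x, q x <= q0 x}.
pose le (s t : T) := `[< forall x, sval t x <= sval s x >].
have [| | | |[q [sq qq0]] qmin] := @Zorn T le.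
- by move=> t; apply/asboolP => x.
- move=> r s t /asboolP rs /asboolP st; apply/asboolP => x.
  exact: le_trans (st x) (rs x).
- move=> [s Hs] [t Ht] /asboolP st /asboolP ts; apply: eq_exist.
  by apply/funext => x; apply/eqP; rewrite eq_le (st x) (ts x).
- move=> A totA; have [A0|] := pselect (A !=set0); last first.
    move=> A0; exists (exist _ q0 (conj sq0 (fun x => lexx _))) => s As.
    by exfalso; apply: A0; exists s.
  pose m x := inf [set sval s x | s in A].
  have mle s x : A s -> m x <= sval s x.
    move=> As; apply: ge_inf; last by exists s.
    exists (- q0 (- x)) => _ [t At <-]; case: t At => t [st tq0] /= _.
    by apply: le_trans (sublinearN x st); rewrite lerN2.
  have lem x r : (forall s, A s -> r <= sval s x) -> r <= m x.
    move=> H; apply: lb_le_inf; first by case: A0 => s As; exists (sval s x), s.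
    by move=> _ [s As <-]; exact: H.
  have sm : sublinear m.
    apply: sublinearW.
    - move=> x y; rewrite -lerBlDr; apply: (lem) => s As.
      rewrite lerBlDr [leRHS]addrC -lerBlDr; apply: (lem) => t At.
      rewrite lerBlDr [leRHS]addrC.
      have [/asboolP st|/asboolP ts] := totA _ _ As At.
        apply: le_trans (mle _ _ At) _; apply: le_trans ((svalP t).1.1 _ _) _.
        exact: lerD.
      apply: le_trans (mle _ _ As) _; apply: le_trans ((svalP s).1.1 _ _) _.
      exact: lerD.
    - move=> t x t0; rewrite mulrC -ler_pdivrMr//; apply: (lem) => s As.
      rewrite ler_pdivrMr// mulrC -((svalP s).1.2 _ _ (ltW t0)).
      exact: mle.
    - apply/eqP; rewrite eq_le; apply/andP; split.
        by case: A0 => s As; apply: le_trans (mle _ _ As) _; rewrite (sublinear0 (svalP s).1).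
      by apply: (lem) => s As; rewrite (sublinear0 (svalP s).1).
  have mq0 x : m x <= q0 x.
    by case: A0 => s As; apply: le_trans (mle _ _ As) _; exact: (svalP s).2.
  exists (exist _ m (conj sm mq0)) => s As; apply/asboolP => x /=; exact: mle.
- exists q; split => // q' sq' q'q.
  have q'q0 x : q' x <= q0 x by exact: le_trans (qq0 x).
  have := qmin (exist _ q' (conj sq' q'q0)).
  by move=> /(_ (asboolT q'q)) /(congr1 sval).
Qed.

(** A minimal functional f below the tilt of q0 at x0.  Minimality gives
    f = tilt f y for all y, hence f x + f y <= f (x + y), and f is linear; the
    tilt forces f (- x0) <= - q0 x0. *)
Theorem hahn_banach q0 x0 : sublinear q0 -> exists f : E -> R,
  [/\ scalar f, forall x, f x <= q0 x & f x0 = q0 x0].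
Proof.
move=> sq0.
have [f [sf ftilt fmin]] := minimal_sublinear (tilt_sublinear x0 sq0).
have fq0 x : f x <= q0 x by exact: le_trans (ftilt x) (tilt_id x0 x sq0).
have fD x y : f (x + y) = f x + f y.
  apply/eqP; rewrite eq_le sf.1 /=.
  have e : tilt f y = f.
    by apply: fmin (tilt_sublinear y sf) _ => z; exact: tilt_id.
  have := @tilt_le f y x 1 sf ler01; rewrite e scale1r mul1r; lra.
have fN x : f (- x) = - f x.
  by apply/eqP; rewrite -addr_eq0 -fD addNr (sublinear0 sf).
exists f; split => //.
  move=> a x y; rewrite fD; congr (_ + _).
  have [a0|/ltW a0] := lerP 0 a; first exact: sf.2.
  by have := sf.2 (- a) x; rewrite scaleNr fN oppr_ge0 mulNr => /(_ a0)/oppr_inj.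
apply/eqP; rewrite eq_le fq0 /=.
have := ftilt (- x0); have := @tilt_le q0 x0 (- x0) 1 sq0 ler01.
rewrite scale1r addNr (sublinear0 sq0) mul1r fN; lra.
Qed.

End hahn_banach.

Section functionals.
Context {R : realType} {E : lmodType R}.
Implicit Types (f : E -> R).

Lemma scalar0 f : scalar f -> f 0 = 0.
Proof. by move=> lf; have := lf (-1) 0 0; rewrite scaler0 addr0; lra. Qed.

Lemma scalarD f x y : scalar f -> f (x + y) = f x + f y.
Proof. by move=> lf; have := lf 1 x y; rewrite scale1r mul1r. Qed.

Lemma scalarMl f a x : scalar f -> f (a *: x) = a * f x.
Proof. by move=> lf; have := lf a x 0; rewrite !addr0 scalar0// addr0. Qed.

Lemma scalarN f x : scalar f -> f (- x) = - f x.
Proof. by move=> lf; rewrite -scaleN1r scalarMl// mulN1r. Qed.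

Lemma scalarB f x y : scalar f -> f (x - y) = f x - f y.
Proof. by move=> lf; rewrite scalarD// scalarN. Qed.

End functionals.

Section separation.
Context {R : realType} {E : tvsType R}.

Definition gauge_of (U : set E) x := inf [set t : R | 0 < t /\ U (t^-1 *: x)].

Lemma separation (U : set E) x0 : nbhs 0 U -> abs_convex U -> ~ U x0 ->
  exists f : E -> R, [/\ scalar f, forall x, U x -> `|f x| <= 1 & 1 <= f x0].
Proof.
move=> nU cU Ux0.
have qle x t : 0 < t -> U (t^-1 *: x) -> gauge_of U x <= t.
  by move=> t0 Ut; apply: ge_inf; [exists 0 => s [/ltW]|].
have leq x r : (forall t, 0 < t -> U (t^-1 *: x) -> r <= t) -> r <= gauge_of U x.
  move=> H; apply: lb_le_inf; last by move=> t [t0 Ut]; exact: H.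
  by have [t t0 Ut] := nbhs0_absorbs x nU; exists t.
have U0 : U 0 by exact: nbhs_singleton.
have sq : sublinear (gauge_of U).
  apply: sublinearW.
  - move=> x y; rewrite -lerBlDr; apply: (leq) => s s0 Us.
    rewrite lerBlDr [leRHS]addrC -lerBlDr; apply: leq => t t0 Ut.
    rewrite lerBlDr [leRHS]addrC; apply: qle; first exact: addr_gt0.
    have -> : (s + t)^-1 *: (x + y) =
        (s / (s + t)) *: (s^-1 *: x) + (t / (s + t)) *: (t^-1 *: y).
      have st : s + t != 0 by rewrite gt_eqF ?addr_gt0.
      rewrite scalerDr !scalerA; congr (_ *: _ + _ *: _); field;
        by rewrite ?st ?gt_eqF.
    have st0 : 0 < s + t by exact: addr_gt0.
    apply: cU => //.
    rewrite !ger0_norm ?(divr_ge0 (ltW _) (ltW _))// -mulrDl divff// gt_eqF//.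
  - move=> t x t0; rewrite mulrC -ler_pdivrMr//; apply: (leq) => s s0 Us.
    rewrite ler_pdivrMr//; apply: qle; first exact: mulr_gt0.
    by rewrite scalerA invfM mulfVK// gt_eqF.
  - apply/eqP; rewrite eq_le; apply/andP; split.
      rewrite leNgt; apply/negP => g0.
      by have := qle 0 (gauge_of U 0 / 2); rewrite scaler0 divr_gt0// => /(_ isT U0); lra.
    by apply: leq => t /ltW.
have [f [lf fq fx0]] := hahn_banach x0 sq.
exists f; split => //.
  have f1 x : U x -> f x <= 1.
    by move=> Ux; apply: le_trans (fq x) _; apply: qle => //; rewrite invr1 scale1r.
  move=> x Ux; rewrite ler_norml f1// lerNl -scalarN// f1//; exact: abs_convexN.
rewrite fx0; apply: leq => t t0 Ut; rewrite leNgt; apply/negP => t1.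
apply: Ux0; have -> : x0 = t *: (t^-1 *: x0).
  by rewrite scalerA divff ?scale1r// gt_eqF.
by apply: abs_convex_balanced => //; rewrite ger0_norm ltW.
Qed.

End separation.

(** * Choice and pigeonhole principles *)

Section choice_principles.

Lemma dependent_choice_nat (T : Type) (P : T -> Prop) (step : nat -> T -> T -> Prop)
    (x0 : T) : P x0 ->
  (forall n x, P x -> exists2 y, P y & step n x y) ->
  exists u : nat -> T, forall n, P (u n) /\ step n (u n) (u n.+1).
Proof.
move=> Px0 H.
have /choice[F HF] : forall nx : nat * T, exists y, P nx.2 -> P y /\ step nx.1 nx.2 y.
  move=> [n x]; have [Px|nPx] := pselect (P x); last by exists x.
  by have [y Py sy] := H n x Px; exists y.
pose u := nat_rect (fun=> T) x0 (fun n x => F (n, x)).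
have Pu n : P (u n) by elim: n => [|n IH] //=; exact: (HF (n, u n) IH).1.
by exists u => n; split => //; exact: (HF (n, u n) (Pu n)).2.
Qed.

(** The predicate N marks the indices at which the construction runs: all of them,
    or those below a bound when only finitely many choices are possible. *)
Lemma greedy_choice (T : Type) (N : nat -> Prop) (good : T -> Prop)
    (rel : T -> T -> Prop) (x0 : T) : (forall k n, (k <= n)%N -> N n -> N k) ->
  (forall n (u : nat -> T), N n -> (forall k, (k < n)%N -> good (u k)) ->
    exists2 x, good x & forall k, (k < n)%N -> rel (u k) x) ->
  exists u : nat -> T, forall n, N n ->
    good (u n) /\ forall k, (k < n)%N -> rel (u k) (u n).
Proof.
move=> Ndown H.
have /choice[F HF] : forall nu : nat * (nat -> T), exists x, N nu.1 ->
    (forall k, (k < nu.1)%N -> good (nu.2 k)) ->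
    good x /\ forall k, (k < nu.1)%N -> rel (nu.2 k) x.
  move=> [n u] /=.
  have [[Nn gu]|nH] := pselect (N n /\ forall k, (k < n)%N -> good (u k)).
    by have [x gx rx] := H n u Nn gu; exists x.
  by exists x0 => Nn gu; exfalso; apply: nH.
pose S := nat_rect (fun=> seq T) [::] (fun n s => rcons s (F (n, nth x0 s))).
pose u n := F (n, nth x0 (S n)).
have SE n : S n = mkseq u n by elim: n => [//|n IH]; rewrite mkseqS -IH.
exists u; elim/ltn_ind => n IH Nn.
have gu k : (k < n)%N -> good (nth x0 (S n) k).
  move=> kn; rewrite SE nth_mkseq//; apply: (IH k kn _).1.
  exact: Ndown (ltnW kn) Nn.
have [gn rn] := HF (n, nth x0 (S n)) Nn gu; split => // k kn.
by have := rn k kn; rewrite /= [in X in rel X]SE nth_mkseq.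
Qed.

End choice_principles.

Section grid.
Context {R : realType}.

(** The colour records in which cell of the grid of mesh tau the vector lies; the
    point is that the number of colours depends on n, r and tau only. *)
Lemma grid_coloring (n : nat) (r tau : R) : 0 < tau -> exists M : nat,
  forall (I : Type) (F : I -> nat -> R),
    (forall i j, (j < n)%N -> `|F i j| <= r) ->
  exists c : I -> 'I_M, forall i i', c i = c i' ->
    forall j, (j < n)%N -> `|F i j - F i' j| <= tau.
Proof.
move=> tau0; pose q := Num.truncn ((r + r) / tau).
exists #|{ffun 'I_n -> 'I_q.+1}| => I F Fr.
pose w i j : nat := Num.truncn ((F i j + r) / tau).
exists (fun i => enum_rank [ffun j : 'I_n => inord (w i j) : 'I_q.+1]).
move=> i i' /enum_rank_inj /ffunP ww j jn.
have /(congr1 val) /= := ww (Ordinal jn); rewrite !ffunE /=.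
have F0 k : 0 <= F k j + r by have := Fr k j jn; rewrite ler_norml; lra.
have wq k : (w k j < q.+1)%N.
  rewrite ltnS; apply: le_truncn; rewrite ler_pM2r ?invr_gt0//.
  by have := Fr k j jn; rewrite ler_norml; lra.
rewrite !inordK// => wE.
have B k : (w k j)%:R * tau <= F k j + r < (w k j).+1%:R * tau.
  rewrite -ler_pdivlMr// -ltr_pdivrMr//; apply: truncn_itv.
  by rewrite divr_ge0// ltW.
have := B i; have := B i'; rewrite wE -natr1 mulrDl mul1r ler_norml; lra.
Qed.

Lemma grid_pigeonhole (n : nat) (r tau : R) : 0 < tau -> exists M : nat,
  forall F : nat -> nat -> R,
    (forall a j, (a < M)%N -> (j < n)%N -> `|F a j| <= r) ->
  exists a b, [/\ (a < b)%N, (b < M)%N &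
    forall j, (j < n)%N -> `|F a j - F b j| <= tau].
Proof.
move=> tau0; have [M HM] := @grid_coloring n r tau tau0.
exists M.+1 => F Fr.
have [|c Hc] := HM 'I_M.+1 (fun a => F a).
  by move=> i j; exact: Fr.
have /injectivePn[a [b ab cab]] : ~~ injectiveb c.
  by apply/negP => /injectiveP /leq_card; rewrite !card_ord ltnn.
have {}Hc := Hc _ _ cab.
have [lt|lt|/val_inj e] := ltngtP a b.
- by exists a, b; split.
- by exists b, a; split => // j jn; rewrite distrC; exact: Hc.
- by rewrite e eqxx in ab.
Qed.

End grid.

(** * Frechet spaces that are not Montel *)

Section frechet.
Context {R : realType} {E : tvsType R}.

Lemma scale_cts (a : R) : continuous (fun x : E => a *: x).
Proof.
move=> x; apply: (@continuous2_cvg _ _ _ _ (nbhs x) _ (cst (a : R^o)) (fun y : E => y)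
  (fun (t : R^o) (y : E) => t *: y)).
- exact: (@scale_continuous R E (a, x)).
- exact: cvg_cst.
- exact: cvg_id.
Qed.

Lemma metrizable_ge0 (T : topologicalType) (d : T -> T -> R) :
  (forall x y, d x y = 0 <-> x = y) -> (forall x y, d x y = d y x) ->
  (forall y x z, d x z <= d x y + d y z) -> forall x y, 0 <= d x y.
Proof.
move=> d0 ds dt x y; have := dt y x x; rewrite [d y x]ds (d0 x x).2//; lra.
Qed.

Lemma metrizable_hausdorff (T : topologicalType) :
  @metrizable R T -> hausdorff_space T.
Proof.
move=> [d [d0 ds dt dn]] p q pq; apply/d0/eqP.
rewrite eq_le (metrizable_ge0 d0 ds dt) andbT leNgt; apply/negP => pos.
have n x : nbhs x [set y | d x y < d p q / 2].
  by apply/dn; exists (d p q / 2) => //; rewrite divr_gt0.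
have [y [/= py qy]] := pq _ _ (n p) (n q).
by have := dt y p q; rewrite (ds y q); lra.
Qed.

Lemma metrizable_base0 : @metrizable R E -> exists V : nat -> set E,
  [/\ forall k, nbhs 0 (V k), forall k, abs_convex (V k) &
      forall A, nbhs 0 A -> exists k, V k `<=` A].
Proof.
move=> [d [d0 ds dt dn]].
have /choice[V HV] : forall k : nat, exists V : set E,
    [/\ nbhs 0 V, abs_convex V & V `<=` [set y | d 0 y < k.+1%:R^-1]].
  move=> k; apply: nbhs0_abs_convex; apply/dn.
  by exists k.+1%:R^-1 => //; rewrite invr_gt0 ltr0n.
exists V; split.
- by move=> k; case: (HV k).
- by move=> k; case: (HV k).
- move=> A /dn[e e0 eA]; exists (Num.truncn e^-1).
  case: (HV (Num.truncn e^-1)) => _ _ Vk x /Vk /= dx; apply: eA => /=.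
  apply: lt_trans dx _; rewrite invf_plt ?posrE ?ltr0n//.
  exact: truncnS_gt.
Qed.

(** Baire's argument.  If the barrel A is no neighborhood of 0, no multiple of A
    contains a translate of a neighborhood of 0, because A is convex and
    symmetric.  So nested translates can be chosen that shrink along the base
    and avoid all the multiples; they converge to a point that A does not
    absorb. *)
Lemma frechet_barrelled : frechet_space E -> barrelled E.
Proof.
move=> [/metrizable_base0[V [nV cV bV]] cplE] A [clA cA bA abA].
have [//|nA] := pselect (nbhs 0 A); exfalso.
pose nn (n : nat) : R := n.+1%:R.
have nn0 n : 0 < nn n by rewrite ltr0n.
pose P (s : E * set E) := nbhs 0 s.2 /\ abs_convex s.2.
pose step n (s t : E * set E) := [/\
  forall w, t.2 w -> s.2 (t.1 + w - s.1),
  forall w w', t.2 w -> t.2 w' -> V n (w + w') &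
  forall w w', t.2 w -> t.2 w' -> ~ A ((nn n)^-1 *: (t.1 + (w + w')))].
have [||u Hu] := @dependent_choice_nat _ P step (0, setT).
- by split; [exact: filterT|].
- move=> n [x W] [/= nW cW].
  have [W1 [nW1 cW1 W1W]] := nbhs0_half nW.
  have [y W1y Ay] : exists2 y, W1 (y - x) & ~ A ((nn n)^-1 *: y).
    apply: contrapT => H.
    have {}H y : W1 (y - x) -> A ((nn n)^-1 *: y).
      by move=> W1y; apply: contrapT => nAy; apply: H; exists y.
    apply: nA.
    (* w is the midpoint of x + w and w - x, the opposite of x - w *)
    have : nbhs 0 ( *:%R (nn n)^-1 @` W1).
      by apply: nbhs0Z => //; rewrite invr_eq0 gt_eqF.
    apply: filterS => _ [w W1w <-].
    have A1 : A ((nn n)^-1 *: (x + w)) by apply: H; rewrite addrC addrA addNr add0r.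
    have A2 : A ((nn n)^-1 *: (w - x)).
      rewrite -opprB scalerN -scaleN1r; apply: (bA (-1)); first by rewrite normrN normr1.
      exists ((nn n)^-1 *: (x - w)) => //.
      by apply: H; rewrite addrAC subrr add0r; exact: abs_convexN.
    have -> : (nn n)^-1 *: w = 2^-1 *: ((nn n)^-1 *: (x + w)) +
        (1 - 2^-1) *: ((nn n)^-1 *: (w - x)).
      have -> : (1 - 2^-1 : R) = 2^-1 by lra.
      rewrite -!scalerDr addrC -addrA addKr scalerA mulrC -scalerA; congr (_ *: _).
      rewrite -{2 3}[w]scale1r -scalerDl scalerA mulVf ?scale1r//.
    by apply: convex_setP => //; lra.
  have nC : nbhs 0 [set z | ~ A ((nn n)^-1 *: (y + z))].
    have : open (~` ((fun z : E => (nn n)^-1 *: z) @^-1` A)).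
      by apply: closed_openC; apply: preimage_closed => // z _; exact: scale_cts.
    move=> oC; have : nbhs y (~` ((fun z : E => (nn n)^-1 *: z) @^-1` A)).
      by apply: open_nbhs_nbhs; split.
    exact: nbhs_shift0.
  have [W2 [nW2 cW2 HW2]] := nbhs0_half (filterI nW1 (filterI (nV n) nC)).
  exists (y, W2); first by split.
  split => /=.
  + move=> w W2w.
    have W1w : W1 w by have := (HW2 w 0 W2w (nbhs_singleton nW2)).1; rewrite addr0.
    by rewrite addrAC; exact: W1W.
  + by move=> w w' Ww Ww'; exact: (HW2 _ _ Ww Ww').2.1.
  + by move=> w w' Ww Ww'; exact: (HW2 _ _ Ww Ww').2.2.
(* the nested translates generate a Cauchy filter *)
pose S n := [set x | (u n).2 (x - (u n).1)].
have SS m n : (n <= m)%N -> S m `<=` S n.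
  elim: m n => [|m IH] n; first by rewrite leqn0 => /eqP ->.
  rewrite leq_eqVlt => /predU1P[-> //|]; rewrite ltnS => /IH; apply: subset_trans.
  move=> x Sx; have [_ [+ _ _]] := Hu m.
  by move=> /(_ _ Sx); rewrite [_ + (x - _)]addrC subrK.
have Su n : S n (u n).1.
  by rewrite /S/= subrr; exact: nbhs_singleton (Hu n).1.1.
pose F := filter_from (setT : set nat) S.
have PF : ProperFilter F.
  apply: filter_from_proper; last by move=> n _; exists (u n).1.
  apply: filter_from_filter; first by exists 0%N.
  move=> i j _ _; exists (maxn i j) => // x Sx.
  by split; apply: SS Sx; rewrite ?leq_maxl ?leq_maxr.
have [|x Fx] := cplE F PF.
  move=> U /bV[n VU]; exists (S n.+1); first by exists n.+1.
  move=> x y Sx Sy; apply: VU.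
  have [_ [_ + _]] := Hu n; have cS := (Hu n.+1).1.2.
  move=> /(_ _ _ Sx (abs_convexN cS Sy)).
  by rewrite opprB addrA subrK.
have : absorbs A [set x] := abA x.
move=> [r r0 Ar].
pose n := Num.truncn r.
have : (A ((nn n)^-1 *: x)).
  have /Ar : r <= `|nn n| by rewrite ger0_norm ?(ltW (nn0 n))// ltW// truncnS_gt.
  move=> /(_ x erefl)[a Aa <-]; rewrite scalerA mulVf ?scale1r// gt_eqF//.
have [[nW cW] _] := Hu n.+1.
have [m _ Sm] : F [set y | (u n.+1).2 (y - x)] by apply: Fx; exact: nbhs0_shift.
have [_ [_ _ H]] := Hu n.
pose y := (u (maxn m n.+1)).1.
have y1 : S n.+1 y by apply: SS (Su _); exact: leq_maxr.
have y2 : (u n.+1).2 (y - x) by apply: Sm; apply: SS (Su _); exact: leq_maxl.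
have := H _ _ y1 (abs_convexN cW y2).
by rewrite opprB addrA [_ + (y - _)]addrC subrK addrC subrK.
Qed.

Lemma totally_bounded_compact (B : set E) : tvs_complete E -> closed B ->
  (forall U : set E, nbhs 0 U -> abs_convex U ->
     exists s : seq E, forall x, B x -> exists2 y, y \in s & U (x - y)) ->
  compact B.
Proof.
move=> cplE clB tB; rewrite compact_ultra => F FU FB.
have [|x Fx] := cplE F _.
  move=> U nU; have [W [nW cW WU]] := nbhs0_half nU.
  have [s Hs] := tB W nW cW.
  have : exists2 y, y \in s & F [set x | W (x - y)].
    have : F [set x | exists2 y, y \in s & W (x - y)] by apply: filterS FB.
    elim: s {Hs} => [|y s IH] Fs.
      by exfalso; apply: (@filter_not_empty _ F _); apply: filterS Fs => x [].
    have [Fy|Fy] := in_ultra_setVsetC [set x | W (x - y)] FU.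
      by exists y; rewrite ?mem_head.
    have [|z zs Fz] := IH; last by exists z => //; rewrite inE zs orbT.
    apply: filterS (filterI Fs Fy) => x [[z]]; rewrite inE => /predU1P[->//|zs] Wz _.
    by exists z.
  move=> [y _ Fy]; exists [set x | W (x - y)] => // a b Wa Wb.
  have := WU _ _ Wa (abs_convexN cW Wb); by rewrite opprB addrA subrK.
exists x; split => //.
apply: clB => A nA.
have FBA : F (B `&` A) by apply: filterI => //; exact: Fx.
have [y [By Ay]] := @filter_ex _ F _ _ FBA.
by exists y.
Qed.

Lemma bounded_not_compact_separated (B : set E) : tvs_complete E -> closed B ->
  ~ compact B -> exists U : set E, [/\ nbhs 0 U, abs_convex U &
    exists e : nat -> E, forall n, B (e n) /\
      forall k, (k < n)%N -> ~ U (e n - e k)].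
Proof.
move=> cplE clB ncB.
have [U [nU cU HU]] : exists U : set E, [/\ nbhs 0 U, abs_convex U &
    forall s : seq E, exists2 x, B x & forall y, y \in s -> ~ U (x - y)].
  apply: contrapT => H; apply: ncB; apply: totally_bounded_compact => // U nU cU.
  apply: contrapT => H'; apply: H; exists U; split => // s.
  apply: contrapT => H''; apply: H'; exists s => x Bx.
  apply: contrapT => H'''; apply: H''; exists x => // y ys Uy.
  by apply: H'''; exists y.
exists U; split => //.
have [||e He] := @greedy_choice E (fun=> True) B (fun y x => ~ U (x - y)) 0 => //.
  move=> n u _ _; have [x Bx Hx] := HU (mkseq u n); exists x => // k kn.
  by apply: Hx; apply/mapP; exists k => //; rewrite mem_iota.
by exists e => n; exact: He.
Qed.

(** Schauder's argument: given f_0, ..., f_(n-1) in the polar of U, two points of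
    the separated sequence e have nearly the same values under all of them, by
    pigeonhole, while their difference is not in U; so some f in the polar
    tells them apart by 1. *)
Lemma polar_separated (U : set E) (e : nat -> E) (r : R) : nbhs 0 U -> abs_convex U ->
  0 < r -> (forall n, U (r^-1 *: e n)) ->
  (forall n k, (k < n)%N -> ~ U (e n - e k)) ->
  exists (f : nat -> E -> R) (z : nat -> E), forall n,
  [/\ scalar (f n), forall x, U x -> `|f n x| <= 1,
      exists a b, z n = e a - e b &
      forall k, (k < n)%N -> 1 / 2 <= f n (z n) - f k (z n)].
Proof.
move=> nU cU r0 Ue sepe.
pose good (p : (E -> R) * E) := [/\ scalar p.1, forall x, U x -> `|p.1 x| <= 1 &
  exists a b, p.2 = e a - e b].
pose rel (p p' : (E -> R) * E) := 1 / 2 <= p'.1 p'.2 - p.1 p'.2.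
have [||u Hu] := @greedy_choice _ (fun=> True) good rel (cst 0, 0) => //; last first.
  exists (fst \o u), (snd \o u) => n; have [[? ? ?] ?] := Hu n I; split => //.
move=> n u _ gu.
have [M HM] := @grid_pigeonhole R n r (1/2) ltac:(by rewrite divr_gt0).
have [|a [b [ab bM Hab]]] := HM (fun a j => (u j).1 (e a)).
  move=> a j _ jn; have [lf fU _] := gu j jn.
  have -> : e a = r *: (r^-1 *: e a) by rewrite scalerA divff ?scale1r// gt_eqF.
  by rewrite scalarMl// normrM (ger0_norm (ltW r0)) -[leRHS]mulr1 ler_pM2l// fU.
have [f [lf fU f1]] := separation nU cU (sepe b a ab).
exists (f, e b - e a); first by split => //=; exists b, a.
move=> k kn; rewrite /rel/=; have [lfk _ _] := gu k kn.
have := Hab k kn; rewrite (scalarB _ _ lfk) distrC ler_norml; lra.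
Qed.

Lemma not_montel_polar : frechet_space E -> ~ montel_space E ->
  exists (U : set E) (f : nat -> E -> R) (z : nat -> E),
  [/\ nbhs 0 U, abs_convex U,
    forall n, scalar (f n) /\ forall x, U x -> `|f n x| <= 1,
    forall k n, (k < n)%N -> 1 / 2 <= f n (z n) - f k (z n) &
    forall V, nbhs 0 V -> exists2 r : R, 0 < r & forall n, V (r^-1 *: z n)].
Proof.
move=> frE nM; have [mE cplE] := frE.
have [B [clB bB ncB]] : exists B : set E, [/\ closed B, tvs_bounded B & ~ compact B].
  apply: contrapT => H; apply: nM; split.
  - exact: metrizable_hausdorff.
  - exact: frechet_barrelled.
  - by move=> B clB bB; apply: contrapT => ncB; apply: H; exists B.
have bB' V : nbhs 0 V -> exists2 r : R, 0 < r & forall x, B x -> V (r^-1 *: x).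
  move=> /bB[r r0 Hr]; exists r => // x Bx.
  have [v Vv <-] := Hr r (ler_norm r) x Bx.
  by rewrite scalerA mulVf ?scale1r// gt_eqF.
have [U [nU cU [e He]]] := bounded_not_compact_separated cplE clB ncB.
have [r r0 Hr] := bB' U nU.
have [||f [z Hfz]] := @polar_separated U e r nU cU r0.
- by move=> n; apply: Hr; exact: (He n).1.
- by move=> n k; exact: (He n).2.
exists U, f, z; split => //.
- by move=> n; have [] := Hfz n.
- by move=> k n kn; have [_ _ _] := Hfz n; exact.
- move=> V /nbhs0_half[W [nW cW WV]]; have [s s0 Hs] := bB' W nW.
  exists s => // n; have [_ _ [a [b ->]] _] := Hfz n.
  rewrite scalerBr; apply: WV; first exact: Hs (He a).1.
  by apply: abs_convexN => //; exact: Hs (He b).1.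
Qed.

End frechet.

(** * A Bessel inequality and monochromatic matchings *)

Section sums.
Context {R : realType}.

Lemma sum_sub_le (T : eqType) (t s : seq T) (F : T -> R) : uniq t -> uniq s ->
  {subset t <= s} -> (forall x, 0 <= F x) -> \sum_(x <- t) F x <= \sum_(x <- s) F x.
Proof.
move=> ut us ts F0; rewrite [leRHS](bigID (mem t))/=.
have pt : perm_eq [seq x <- s | x \in t] t.
  apply: uniq_perm => //; first exact: filter_uniq.
  by move=> x; rewrite mem_filter; apply: andb_idr; exact: ts.
rewrite -[X in _ <= X + _]big_filter (perm_big _ pt).
by rewrite lerDl; exact: sumr_ge0.
Qed.

(** The column vectors of A are almost orthogonal, so a combination of N of them
    with signs has squared norm of order N n rather than N^2 n; it is then
    paired with b by the inequality 2 B b <= t B^2 + b^2 / t, in which the free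
    parameter t spares the square root of Cauchy-Schwarz. *)
Lemma bessel_like (n N : nat) (A : 'I_n -> 'I_N -> R) (b : 'I_n -> R) (t : R) :
  0 < t ->
  (forall j k, j != k -> `|\sum_i A i j * A i k| <= n%:R / N%:R) ->
  (forall k, \sum_i A i k ^+ 2 <= 4 * n%:R) -> \sum_i b i ^+ 2 <= n%:R ->
  \sum_k `|\sum_i A i k * b i| <= n%:R * (5 * N%:R * t + t^-1).
Proof.
move=> t0 Aorth Adiag bn.
have [N0|N0] := posnP N.
  move: A Aorth Adiag; rewrite N0 => A _ _; rewrite big_ord0.
  by rewrite mulr_ge0// mulr0 mul0r add0r invr_ge0 ltW.
have N0' : 0 < N%:R :> R by rewrite ltr0n.
pose e k := Num.sg (\sum_i A i k * b i).
pose B i := \sum_k e k * A i k.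
have -> : \sum_k `|\sum_i A i k * b i| = \sum_i B i * b i.
  under eq_bigr => k _ do rewrite normrEsg mulr_sumr.
  rewrite exchange_big; apply: eq_bigr => i _; rewrite /B mulr_suml.
  by apply: eq_bigr => k _; rewrite mulrA.
have B2 : \sum_i B i ^+ 2 <= 5 * N%:R * n%:R.
  have -> : \sum_i B i ^+ 2 = \sum_j \sum_k (e j * e k) * \sum_i A i j * A i k.
    under eq_bigr => i _ do rewrite expr2 /B mulr_suml.
    rewrite exchange_big; apply: eq_bigr => j _.
    under eq_bigr => i _ do rewrite mulr_sumr.
    rewrite exchange_big; apply: eq_bigr => k _; rewrite mulr_sumr.
    by apply: eq_bigr => i _; ring.
  have e1 k : `|e k| <= 1 by rewrite normr_sg; case: (_ != 0).
  apply: (@le_trans _ _ (\sum_(j < N) (5 * n%:R))); last first.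
    by rewrite sumr_const card_ord -[leLHS]mulr_natr [leRHS](_ : _ = 5 * n%:R * N%:R)//; ring.
  apply: ler_sum => j _.
  rewrite (bigD1 j)//=.
  apply: (@le_trans _ _ (4 * n%:R + \sum_(k < N) n%:R / N%:R)); last first.
    rewrite sumr_const card_ord -[X in _ + X <= _]mulr_natr mulfVK ?gt_eqF//.
    by rewrite [leRHS](_ : _ = 4 * n%:R + n%:R)//; ring.
  apply: lerD.
    apply: le_trans (Adiag j).
    rewrite (eq_bigr (fun i => A i j ^+ 2)); last by move=> i _; rewrite expr2.
    apply: ler_piMl; first by apply: sumr_ge0 => i _; exact: sqr_ge0.
    by apply: le_trans (ler_norm _) _; rewrite normrM mulr_ile1.
  apply: (@le_trans _ _ (\sum_(k < N | k != j) n%:R / N%:R)); last first.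
    rewrite [leRHS](bigID (fun k => k != j))/= lerDl.
    by apply: sumr_ge0 => k _; rewrite divr_ge0// ltW.
  apply: ler_sum => k kj.
  apply: le_trans (ler_norm _) _; rewrite normrM.
  apply: le_trans (Aorth j k _); last by rewrite eq_sym.
  by apply: ler_piMl => //; rewrite normrM mulr_ile1.
apply: (@le_trans _ _ (\sum_i (t * B i ^+ 2 + t^-1 * b i ^+ 2))).
  apply: ler_sum => i _.
  have : 0 <= (t * B i - b i) ^+ 2 * t^-1 by rewrite mulr_ge0 ?sqr_ge0// invr_ge0 ltW.
  have -> : (t * B i - b i) ^+ 2 * t^-1 = t * B i ^+ 2 + t^-1 * b i ^+ 2 - 2 * (B i * b i).
    by field; rewrite gt_eqF.
  have : 0 <= t * B i ^+ 2 + t^-1 * b i ^+ 2.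
    by rewrite addr_ge0// mulr_ge0 ?sqr_ge0// ?invr_ge0 ltW.
  lra.
rewrite big_split/= -!mulr_sumr.
have -> : n%:R * (5 * N%:R * t + t^-1) = t * (5 * N%:R * n%:R) + t^-1 * n%:R :> R by ring.
by apply: lerD; rewrite ler_pM2l ?invr_gt0.
Qed.

End sums.

(** As long as more than M indices remain, two of them have the same colour;
    pair these and remove them.  Disjoint pairs are needed in order that a sum
    over the pairs be dominated by the sum over all indices. *)
Lemma monochromatic_matching (M : nat) (c : nat -> 'I_M) (s : seq nat) : uniq s ->
  exists S : seq (nat * nat), [/\ uniq (unzip1 S ++ unzip2 S),
    {subset unzip1 S ++ unzip2 S <= s},
    forall p, p \in S -> (p.1 < p.2)%N /\ c p.1 = c p.2 &
    (size s <= 2 * size S + M)%N].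
Proof.
have [n] := ubnP (size s); elim: n s => [//|n IH] s; rewrite ltnS => sn us.
have [sM|Ms] := leqP (size s) M; first by exists [::]; split.
have [i [j [ij is' js cij]]] : exists i j, [/\ (i < j)%N, i \in s, j \in s & c i = c j].
  have nu : ~~ uniq (map c s).
    apply/negP => /card_uniqP; rewrite size_map => cs.
    by have := max_card (mem (map c s)); rewrite cs card_ord leqNgt Ms.
  apply: contrapT => H; move/negP: nu; apply; rewrite map_inj_in_uniq// => a b as' bs cab.
  have [ab|ba|//] := ltngtP a b; exfalso; apply: H.
    by exists a, b.
  by exists b, a.
pose s' := rem j (rem i s).
have us' : uniq s' by rewrite !rem_uniq.
have jri : j \in rem i s by rewrite mem_rem_uniq// inE js andbT neq_ltn ij orbT.
have szs : size s = (size s').+2.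
  rewrite /s' size_rem// size_rem//.
  by case: (s) Ms is' jri => // x [|y l]//=; rewrite inE => _ /eqP ->; rewrite eqxx.
have [||S [uS Ss cS szS]] := IH s' => //.
  by apply: leq_trans sn; rewrite szs; exact: leqnSn.
have s's x : x \in s' -> [/\ x \in s, x != i & x != j].
  by rewrite /s' mem_rem_uniq ?rem_uniq// !inE mem_rem_uniq// inE => /and3P[-> -> ->].
exists ((i, j) :: S); split.
- have iS : i \notin unzip1 S ++ unzip2 S.
    by apply/negP => /Ss /s's[_]; rewrite eqxx.
  have jS : j \notin unzip1 S ++ unzip2 S.
    by apply/negP => /Ss /s's[_ _]; rewrite eqxx.
  rewrite /= mem_cat inE.
  rewrite -(cat1s j) uniq_catCA /= jS uS andbT.
  by move: iS; rewrite mem_cat !negb_or => /andP[-> ->]; rewrite neq_ltn ij.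
- move=> x; rewrite /= inE mem_cat /= inE.
  move=> /predU1P[->//|/orP[xS|/predU1P[->//|xS]]].
    by have /Ss/s's[] : x \in unzip1 S ++ unzip2 S by rewrite mem_cat xS.
  by have /Ss/s's[] : x \in unzip1 S ++ unzip2 S by rewrite mem_cat xS orbT.
- by move=> p; rewrite inE => /predU1P[->//|/cS].
- by rewrite szs /= mulnS -addnA !addSn ltnS ltnS.
Qed.

(** * Null systems *)

Section null_systems.
Context {R : realType} {E : tvsType R}.

(** The substitute for a weak* null sequence that is not uniformly null on
    bounded sets: the averages over the finite families are weak* null.
    Boundedness of the vectors w n i is asked for large n only, so that it can
    be achieved one neighborhood at a time. *)
Definition null_system (U : set E) (l : nat -> nat) (h : nat -> nat -> E -> R)
    (w : nat -> nat -> E) :=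
  [/\ forall n, (0 < l n)%N,
      forall n i, (i < l n)%N -> scalar (h n i) /\ forall x, U x -> `|h n i x| <= 1,
      forall x, U x -> forall eps : R, 0 < eps -> exists N, forall n, (N <= n)%N ->
        \sum_(i < l n) `|h n i x| <= (l n)%:R * eps,
      forall n i, (i < l n)%N -> h n i (w n i) = 1 &
      forall A : set E, nbhs 0 A -> exists r N, 0 < r /\
        forall n i, (N <= n)%N -> (i < l n)%N -> A (r^-1 *: w n i)].

Variables (U : set E) (f : nat -> E -> R) (z : nat -> E) (V : nat -> set E).
Hypothesis nU : nbhs 0 U.
Hypothesis cU : abs_convex U.
Hypothesis lf : forall n, scalar (f n).
Hypothesis fU : forall n x, U x -> `|f n x| <= 1.
Hypothesis fz : forall k n, (k < n)%N -> 1 / 2 <= f n (z n) - f k (z n).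
Hypothesis bz : forall A : set E, nbhs 0 A -> exists2 r : R, 0 < r & forall n, A (r^-1 *: z n).
Hypothesis nV : forall k, nbhs 0 (V k).
Hypothesis cV : forall k, abs_convex (V k).
Hypothesis bV : forall A : set E, nbhs 0 A -> exists k, V k `<=` A.

(** Neighborhoods of 0 that get smaller as s gets longer; along an infinite branch
    their intersection is bounded, and every x in U lies on some branch. *)
Definition slab (s : seq nat) : set E :=
  [set x | U x /\ forall j, (j < size s)%N -> V j ((nth 0%N s j).+1%:R^-1 *: x)].

Lemma slab0 s : slab s 0.
Proof.
split; first exact: nbhs_singleton.
by move=> j _; rewrite scaler0; exact: nbhs_singleton.
Qed.

Lemma slab_prefix x : U x -> exists lambda : nat -> nat, forall k, slab (mkseq lambda k) x.
Proof.
move=> Ux; have /choice[lambda Hl] : forall j, exists m : nat, V j (m.+1%:R^-1 *: x).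
  move=> j; have [r r0 Vr] := nbhs0_absorbs x (nV j).
  exists (Num.truncn r).
  have -> : (Num.truncn r).+1%:R^-1 *: x = (r / (Num.truncn r).+1%:R) *: (r^-1 *: x).
    by rewrite scalerA mulrAC divff ?mul1r// gt_eqF.
  apply: abs_convex_balanced => //; rewrite ger0_norm ?divr_ge0 ?(ltW r0)//.
  by rewrite ler_pdivrMr ?ltr0n// mul1r ltW// truncnS_gt.
by exists lambda => k; split => // j; rewrite size_mkseq => jk; rewrite nth_mkseq.
Qed.

(** The length n of the samples (f_i x)_(i<n) may depend on the number K of points.
    Only the failure of this property gives nets of a size independent of n. *)
Definition separated_points (c : R) (s : seq nat) := forall K, exists n (x : nat -> E),
  [/\ (0 < n)%N, forall a, (a < K)%N -> slab s (x a) &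
      forall a b, (a < b)%N -> (b < K)%N ->
        n%:R * c ^+ 2 <= \sum_(i < n) (f i (x b) - f i (x a)) ^+ 2].

Definition ip n x y := \sum_(i < n) f i x * f i y.

Lemma ipC n x y : ip n x y = ip n y x.
Proof. by apply: eq_bigr => i _; rewrite mulrC. Qed.

Lemma ip_bound n x y a b : 0 <= a -> 0 <= b ->
  (forall i, `|f i x| <= a) -> (forall i, `|f i y| <= b) ->
  `|ip n x y| <= n%:R * (a * b).
Proof.
move=> a0 b0 xa yb; apply: le_trans (ler_norm_sum _ _ _) _.
rewrite (_ : n%:R * (a * b) = \sum_(i < n) (a * b)).
  by apply: ler_sum => i _; rewrite normrM ler_pM.
by rewrite sumr_const card_ord -[RHS]mulr_natr mulrC.
Qed.

(** Each new vector is the difference of two among sufficiently many separated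
    points that have almost the same inner products with the vectors chosen so
    far; it is therefore almost orthogonal to these. *)
Lemma almost_orthogonal c s N : 0 < c -> separated_points c s ->
  exists n (u : nat -> E), (0 < n)%N /\ forall k, (k < N)%N ->
    [/\ exists x y, [/\ slab s x, slab s y & u k = x - y],
        n%:R * c ^+ 2 <= ip n (u k) (u k) &
        forall j, (j < k)%N -> `|ip n (u j) (u k)| <= n%:R / N%:R].
Proof.
move=> c0 sep.
have [N0|N0] := posnP N; first by exists 1%N, (cst 0); split => // k; rewrite N0.
have N0' : 0 < N%:R :> R by rewrite ltr0n.
have [|K HK] := @grid_pigeonhole R N 2 N%:R^-1; first by rewrite invr_gt0.
have [n [x [n0 xs xsep]]] := sep K.
have n0' : 0 < n%:R :> R by rewrite ltr0n.
pose good u := (exists a b, [/\ slab s a, slab s b & u = a - b]) /\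
  n%:R * c ^+ 2 <= ip n u u.
pose rel u v := `|ip n u v| <= n%:R / N%:R.
have [||u Hu] := @greedy_choice E (fun k => (k < N)%N) good rel 0.
- by move=> k m km; apply: leq_ltn_trans.
- move=> k u kN gu.
  (* K was fixed for N test vectors; those not yet chosen are replaced by 0 *)
  have [|a [b [ab bK Hab]]] :=
    HK (fun a j => if (j < k)%N then ip n (x a) (u j) / n%:R else 0).
    move=> a j aK jN; case: ifPn => jk; last by rewrite normr0.
    rewrite normrM normfV (ger0_norm (ltW n0')) ler_pdivrMr// mulrC.
    rewrite -[2]mul1r; apply: ip_bound => //.
      by move=> i; apply: fU; exact: (xs a aK).1.
    move=> i; have [[y [y' [[Uy _] [Uy' _] ->]]] _] := gu j jk.
    rewrite scalarB//; apply: le_trans (ler_normB _ _) _.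
    by have := fU i Uy; have := fU i Uy'; lra.
  exists (x b - x a).
    split; first by exists (x b), (x a); split => //; apply: xs => //; exact: ltn_trans bK.
    have := xsep a b ab bK; rewrite /ip; congr (_ <= _).
    by apply: eq_bigr => i _; rewrite scalarB// expr2.
  move=> j jk; rewrite /rel.
  have := Hab j (ltn_trans jk kN); rewrite jk -mulrBl normrM normfV (ger0_norm (ltW n0')).
  rewrite ler_pdivrMr// mulrC; congr (_ <= _); rewrite -normrN; congr (`|_|).
  rewrite opprB ipC /ip -sumrB; apply: eq_bigr => i _; rewrite scalarB//; ring.
exists n, u; split => // k kN; have [[? ?] ?] := Hu k kN; split => //.
Qed.

(** The N-th family consists of N + 1 almost orthogonal vectors u_k, taken from
    the slab of the first N terms of lambda; the functionals are the inner
    products with them.  Differences of elements of U have samples bounded by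
    2, whence the normalization by 2 n. *)
Lemma null_system_orthogonal c (lambda : nat -> nat) : 0 < c ->
  (forall k, separated_points c (mkseq lambda k)) -> exists l h w, null_system U l h w.
Proof.
move=> c0 sep.
have /choice[n] : forall N : nat, exists n : nat, exists u : nat -> E, (0 < n)%N /\
    forall k, (k < N.+1)%N ->
    [/\ exists x y, [/\ slab (mkseq lambda N) x, slab (mkseq lambda N) y & u k = x - y],
        n%:R * c ^+ 2 <= ip n (u k) (u k) &
        forall j, (j < k)%N -> `|ip n (u j) (u k)| <= n%:R / N.+1%:R].
  by move=> N; exact: almost_orthogonal.
move=> /choice[u Hu].
have n0 N : 0 < (n N)%:R :> R by rewrite ltr0n; case: (Hu N).
have n2 N : 0 < 2 * (n N)%:R :> R by exact: mulr_gt0.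
have fu N k i : (k < N.+1)%N -> `|f i (u N k)| <= 2.
  move=> kN; have [_ /(_ k kN)[[x [y [[Ux _] [Uy _] ->]]] _ _]] := Hu N.
  rewrite scalarB//; apply: le_trans (ler_normB _ _) _.
  by have := fU i Ux; have := fU i Uy; lra.
have uu0 N k : (k < N.+1)%N -> 0 < ip (n N) (u N k) (u N k).
  move=> kN; have [_ /(_ k kN)[_ + _]] := Hu N; apply: lt_le_trans.
  by rewrite mulr_gt0// exprn_gt0.
exists succn, (fun N k x => ip (n N) (u N k) x / (2 * (n N)%:R)),
  (fun N k => (2 * (n N)%:R / ip (n N) (u N k) (u N k)) *: u N k).
have lip m v : scalar (ip m v).
  move=> a x y; rewrite /ip mulr_sumr -big_split; apply: eq_bigr => i _.
  by rewrite lf /=; ring.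
split => //.
- move=> N k kN; split.
    by move=> a x y; rewrite lip /=; ring.
  move=> x Ux; rewrite normrM normfV (ger0_norm (ltW (n2 N))) ler_pdivrMr// mul1r mulrC.
  by rewrite -[2]mulr1; apply: ip_bound => // i; [exact: fu|exact: fU].
- move=> x Ux eps eps0.
  (* this t makes both terms of the Bessel bound at most (n N) (N + 1) eps *)
  pose t := eps / 5; have t0 : 0 < t by rewrite divr_gt0.
  exists (Num.truncn (t^-1 / eps)) => N HN.
  have B : \sum_(k < N.+1) `|ip (n N) (u N k) x| <= (n N)%:R * (5 * N.+1%:R * t + t^-1).
    apply: (@bessel_like R (n N) N.+1 (fun i k => f i (u N k)) (fun i => f i x)) => //.
    + move=> j k jk.
      wlog lt : j k jk / (j < k)%N.
        move=> W; have [lt|lt|/val_inj e] := ltngtP j k; first exact: W.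
          rewrite (eq_bigr (fun i : 'I__ => f i (u N k) * f i (u N j))); last first.
            by move=> i _; rewrite mulrC.
          by apply: W; rewrite // eq_sym.
        by rewrite e eqxx in jk.
      by have [_ /(_ k (ltn_ord k))[_ _]] := Hu N; apply.
    + move=> k; have fuk i := fu N k i (ltn_ord k).
      have := @ip_bound (n N) (u N k) (u N k) 2 2 _ _ fuk fuk.
      move=> /(_ ltac:(lra) ltac:(lra)) /(le_trans (ler_norm _)).
      rewrite /ip; under eq_bigr => i _ do rewrite -expr2.
      by move=> /le_trans; apply; rewrite mulrC; lra.
    + apply: (@le_trans _ _ (\sum_(i < n N) 1)); last by rewrite sumr_const card_ord.
      apply: ler_sum => i _; rewrite -[_ ^+ 2]ger0_norm ?sqr_ge0//.
      by rewrite normrX exprn_ile1// fU.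
  rewrite (eq_bigr (fun k : 'I_N.+1 => `|ip (n N) (u N k) x| / (2 * (n N)%:R))); last first.
    by move=> k _; rewrite normrM normfV (ger0_norm (ltW (n2 N))).
  rewrite -mulr_suml ler_pdivrMr//; apply: le_trans B _.
  rewrite [leRHS](_ : _ = (n N)%:R * (2 * (N.+1%:R * eps))); last by ring.
  rewrite ler_pM2l//.
  have : t^-1 <= N.+1%:R * eps.
    rewrite -ler_pdivrMr//; apply: le_trans (ltW (truncnS_gt _)) _.
    by rewrite ler_nat ltnS.
  by rewrite /t; lra.
- move=> N k kN; rewrite scalarMl//; field.
  by rewrite !gt_eqF// ?uu0.
- move=> A /nbhs0_half[W [nW cW WA]]; have [j VW] := bV nW.
  exists ((lambda j).+1%:R * (2 / c ^+ 2)), j.+1; split.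
    by rewrite mulr_gt0 ?ltr0n// divr_gt0// exprn_gt0.
  move=> N k jN kN.
  have [_ /(_ k kN)[[x [y [[Ux Vx] [Uy Vy] ->]]] Hip _]] := Hu N.
  have lj : (lambda j).+1%:R != 0 :> R by rewrite pnatr_eq0.
  have c2 : 0 < c ^+ 2 by rewrite exprn_gt0.
  pose kap := (n N)%:R * c ^+ 2 / ip (n N) (x - y) (x - y).
  have ip0 : 0 < ip (n N) (x - y) (x - y) by apply: lt_le_trans Hip; exact: mulr_gt0.
  have kap1 : `|kap| <= 1.
    by rewrite ger0_norm ?divr_ge0 ?(ltW ip0)// ?ler_pdivrMr ?mul1r// ltW// mulr_gt0.
  have -> : ((lambda j).+1%:R * (2 / c ^+ 2))^-1 *:
      ((2 * (n N)%:R / ip (n N) (x - y) (x - y)) *: (x - y)) =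
      kap *: ((lambda j).+1%:R^-1 *: x) + kap *: - ((lambda j).+1%:R^-1 *: y).
    rewrite -scalerDr -scalerBr !scalerA; congr (_ *: _); rewrite /kap; field.
    by rewrite nat1r lj !gt_eqF.
  have slabW v : slab (mkseq lambda N) v -> W ((lambda j).+1%:R^-1 *: v).
    by move=> [_ /(_ j)]; rewrite size_mkseq nth_mkseq// => /(_ jN)/VW.
  apply: WA; apply: abs_convex_balanced => //; first exact: slabW.
  by apply: abs_convexN => //; exact: slabW.
Qed.

(** A failed greedy search for K separated points leaves a net of K points. *)
Lemma finite_net c s : ~ separated_points c s -> exists K, forall n, (0 < n)%N ->
  exists x : nat -> E, (forall a, (a < K)%N -> slab s (x a)) /\
    forall y, slab s y -> exists2 a, (a < K)%N &
      \sum_(i < n) (f i y - f i (x a)) ^+ 2 <= n%:R * c ^+ 2.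
Proof.
move=> nsep; apply: contrapT => nnet; apply: nsep => K.
have [n n0 Hn] : exists2 n, (0 < n)%N & forall x : nat -> E,
    (forall a, (a < K)%N -> slab s (x a)) -> exists2 y, slab s y &
    forall a, (a < K)%N -> n%:R * c ^+ 2 <= \sum_(i < n) (f i y - f i (x a)) ^+ 2.
  apply: contrapT => H; apply: nnet; exists K => n n0.
  apply: contrapT => H'; apply: H; exists n => // x xs.
  apply: contrapT => H''; apply: H'; exists x; split => // y ys.
  apply: contrapT => H'''; apply: H''; exists y => // a aK.
  by rewrite leNgt; apply/negP => lt; apply: H'''; exists a => //; exact: ltW.
have [||x Hx] := @greedy_choice E (fun k => (k < K)%N) (slab s)
    (fun x y => n%:R * c ^+ 2 <= \sum_(i < n) (f i y - f i x) ^+ 2) 0.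
- by move=> k m km; exact: leq_ltn_trans.
- move=> k u kK us.
  have [|y ys Hy] := Hn (fun a => if (a < k)%N then u a else 0).
    by move=> a _; case: ifPn => [/us//|_]; exact: slab0.
  exists y => // a ak; have := Hy a (ltn_trans ak kK); by rewrite ak.
exists n, x; split => //.
- by move=> a /Hx[].
- by move=> a b ab /Hx[_]; apply.
Qed.

(** Up to an error c in the mean, the samples of the points of the slab are
    functions of the colour. This persists when the colouring is refined, with
    the same g: this is what allows all slabs to be treated at once. *)
Definition nearly_constant (c : R) (s : seq nat) n (col : nat -> nat) :=
  forall y, slab s y -> exists2 g : nat -> R,
    \sum_(i < n) `|f i y - g i| <= n%:R * c &
    forall i j, col i = col j -> `|g i - g j| <= c.

(** Colour i by the approximate values of f_i at the points of a finite net; for y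
    in the slab take for g the sample of the nearest point of the net.  The
    number of colours does not depend on n. *)
Lemma coloring_of_net c s : 0 < c -> ~ separated_points c s -> exists M, forall n,
  exists col : nat -> 'I_M, nearly_constant c s n col.
Proof.
move=> c0 /finite_net[K HK]; have [M HM] := @grid_coloring R K 1 c c0.
exists M => n.
have [->|n0] := posnP n.
  have [|col _] := HM nat (fun _ _ => 0); first by move=> i j _; rewrite normr0.
  exists col => y _; exists (cst 0); first by rewrite big_ord0 mul0r.
  by move=> i j _; rewrite subrr normr0 ltW.
have [x [xs netx]] := HK n n0.
have [|col Hcol] := HM nat (fun i a => f i (x a)).
  by move=> i a aK; apply: fU; exact: (xs a aK).1.
exists col => y ys; have [a aK ya] := netx y ys; exists (fun i => f i (x a)); last first.
  by move=> i j cij; apply: Hcol => //; exact: val_inj.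
apply: (@le_trans _ _ (\sum_(i < n) (((f i y - f i (x a)) ^+ 2 / c + c) / 2))).
  apply: ler_sum => i _; set v := _ - _.
  rewrite ler_pdivlMr// -lerBlDr ler_pdivlMr// -[v ^+ 2]real_normK ?num_real//.
  by have := sqr_ge0 (`|v| - c); lra.
rewrite -mulr_suml big_split/= -mulr_suml sumr_const card_ord -[X in _ + X]mulr_natr.
rewrite ler_pdivrMr// [leRHS](_ : _ = n%:R * c + c * n%:R); last by ring.
rewrite lerD2r ler_pdivrMr//; apply: le_trans ya _.
by rewrite expr2 mulrA.
Qed.

(** The common refinement of the colourings for the first r pairs (s, m) in an
    enumeration; M bounds the number of colours for all n, so the number of
    indices can afterwards be taken as a multiple of M. *)
Lemma joint_coloring r : exists M, forall n, exists col : nat -> 'I_M,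
  forall s m, (pickle (s, m) < r)%N -> ~ separated_points m.+1%:R^-1 s ->
    nearly_constant m.+1%:R^-1 s n col.
Proof.
elim: r => [|r [M IH]]; first by exists 1%N => n; exists (fun=> ord0).
have [[s [m [smr nsep]]]|none] := pselect (exists s m,
    pickle (s : seq nat, m : nat) = r /\ ~ separated_points m.+1%:R^-1 s); last first.
  exists M => n; have [col Hcol] := IH n; exists col => s m.
  rewrite ltnS leq_eqVlt => /predU1P[e nsep|lt nsep]; last exact: Hcol.
  by exfalso; apply: none; exists s, m.
have m0 : 0 < m.+1%:R^-1 :> R by rewrite invr_gt0 ltr0n.
have [M' HM'] := coloring_of_net m0 nsep.
exists #|{: 'I_M * 'I_M'}| => n.
have [col Hcol] := IH n; have [col' Hcol'] := HM' n.
exists (fun i => enum_rank (col i, col' i)) => s' m'.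
have inj i j : enum_rank (col i, col' i) = enum_rank (col j, col' j) :> nat ->
    col i = col j /\ col' i = col' j.
  by move=> /val_inj/enum_rank_inj[].
rewrite ltnS leq_eqVlt => /predU1P[e _|lt nsep'] y ys.
  have [es em] : s' = s /\ m' = m.
    by have := pcan_inj pickleK (etrans e (esym smr)) => -[].
  move: ys; rewrite es em => ys; have [g gy gc] := Hcol' y ys.
  by exists g => // i j /inj[_ cij]; apply: gc; rewrite cij.
have [g gy gc] := Hcol s' m' lt nsep' y ys.
by exists g => // i j /inj[cij _]; apply: gc; rewrite cij.
Qed.

(** At stage r, with M colours, take 3 M indices and at least M disjoint
    monochromatic pairs i < j; the functionals are the (f_j - f_i) / 2, tested
    on z_j.  A given x in U and precision are dealt with at all stages after the
    pair (s, m) for which s is the first segment of the branch of x that fails to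
    have separated points. *)
Lemma null_system_matching :
  (forall (c : R) lambda, 0 < c -> exists k, ~ separated_points c (mkseq lambda k)) ->
  exists l h w, null_system U l h w.
Proof.
move=> nsep.
have [M HM] := choice (@joint_coloring).
have /choice[S HS] : forall r, exists S : seq (nat * nat), exists col : nat -> 'I_(M r),
    [/\ uniq (unzip1 S ++ unzip2 S), {subset unzip1 S ++ unzip2 S <= iota 0 (3 * M r)},
    forall p, p \in S -> (p.1 < p.2)%N /\ col p.1 = col p.2,
    (M r <= size S)%N &
    forall s m, (pickle (s, m) < r)%N -> ~ separated_points m.+1%:R^-1 s ->
      nearly_constant m.+1%:R^-1 s (3 * M r) col].
  move=> r; have [col Hcol] := HM r (3 * M r)%N.
  have [S [uS sS cS szS]] := monochromatic_matching col (iota_uniq 0 (3 * M r)).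
  by exists S, col; split => //; move: szS; rewrite size_iota; lia.
have M0 r : (0 < M r)%N by have [col _] := HS r; case: (M r) (col 0%N) => // -[].
pose p r i := nth (0%N, 0%N) (S r) i.
pose h r i x := (f (p r i).2 x - f (p r i).1 x) / 2.
pose w r i := (h r i (z (p r i).2))^-1 *: z (p r i).2.
have lh r i : scalar (h r i) by move=> a x y; rewrite /h !lf /=; ring.
have hz r i : (i < size (S r))%N -> 1 / 4 <= h r i (z (p r i).2).
  move=> ir; have [_ [_ _ /(_ _ (mem_nth (0, 0)%N ir))[lt _] _ _]] := HS r.
  by have := fz lt; rewrite /h; lra.
exists (fun r => size (S r)), h, w; split => //.
- by move=> r; have [_ [_ _ _ szS _]] := HS r; exact: leq_trans szS.
- move=> r i _; split => // x Ux; rewrite /h normrM [`|2^-1|]ger0_norm ?invr_ge0//.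
  rewrite ler_pdivrMr// mul1r; apply: le_trans (ler_normB _ _) _.
  by have := fU (p r i).2 Ux; have := fU (p r i).1 Ux; lra.
- move=> x Ux eps eps0.
  have [lambda Hl] := slab_prefix Ux.
  pose m := Num.truncn (2 / eps).
  pose c : R := m.+1%:R^-1.
  have c0 : 0 < c by rewrite invr_gt0 ltr0n.
  have ce : 2 * c <= eps.
    rewrite /c ler_pdivrMr ?ltr0n// mulrC -ler_pdivrMr//; exact: ltW (truncnS_gt _).
  have [k nsepk] := nsep c lambda c0.
  exists (pickle (mkseq lambda k, m)).+1 => r kr.
  have [col [uS sS cS szS Hcol]] := HS r.
  have [g gy gc] := Hcol _ _ kr nsepk x (Hl k).
  have -> : \sum_(i < size (S r)) `|h r i x| = \sum_(q <- S r) `|(f q.2 x - f q.1 x) / 2|.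
    by rewrite (big_nth (0%N, 0%N)) big_mkord.
  apply: (@le_trans _ _ (\sum_(q <- S r) (`|f q.1 x - g q.1| + `|f q.2 x - g q.2| + c) / 2)).
    rewrite big_seq [leRHS]big_seq; apply: ler_sum => q qS.
    rewrite normrM [`|2^-1|]ger0_norm ?invr_ge0// ler_pM2r ?invr_gt0//.
    have [_ /(congr1 val)/gc] := cS q qS; rewrite -/c => gq.
    have -> : f q.2 x - f q.1 x =
      (f q.2 x - g q.2) - (f q.1 x - g q.1) - (g q.1 - g q.2) by ring.
    apply: le_trans (ler_normB _ _) _; apply: lerD => //.
    by rewrite [leRHS]addrC; exact: ler_normB.
  rewrite -mulr_suml big_split/= ler_pdivrMr//.
  have -> : \sum_(q <- S r) c = (size (S r))%:R * c.
    by rewrite big_const_seq count_predT iter_addr_0 mulr_natl.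
  have : \sum_(q <- S r) (`|f q.1 x - g q.1| + `|f q.2 x - g q.2|) <= (3 * M r)%:R * c.
    rewrite big_split/= -(big_map fst predT (fun i => `|f i x - g i|)).
    rewrite -(big_map snd predT (fun i => `|f i x - g i|)) -big_cat/=.
    apply: le_trans gy; rewrite -(big_mkord predT (fun i => `|f i x - g i|)).
    by apply: sum_sub_le => //; rewrite /index_iota subn0// iota_uniq.
  have : (3 * M r)%:R * c <= 3 * (size (S r))%:R * c.
    by rewrite ler_pM2r// natrM ler_pM2l// ler_nat.
  have : (size (S r))%:R * (2 * c) <= (size (S r))%:R * eps by exact: ler_wpM2l.
  lra.
- move=> r i ir; rewrite /w scalarMl// mulVf// gt_eqF//.
  by apply: lt_le_trans (hz r i ir); lra.
- move=> A /nbhs0_abs_convex[W [nW cW WA]]; have [r r0 Wr] := bz nW.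
  exists (r * 4), 0%N; split; first by rewrite mulr_gt0.
  move=> n i _ ir; rewrite /w scalerA; apply: WA.
  have h0 : 0 < h n i (z (p n i).2) by apply: lt_le_trans (hz n i ir); lra.
  have -> : (r * 4)^-1 / h n i (z (p n i).2) = (4 * h n i (z (p n i).2))^-1 * r^-1.
    by field; rewrite !gt_eqF.
  rewrite -scalerA; apply: abs_convex_balanced => //.
  have h4 : 0 < 4 * h n i (z (p n i).2) by exact: mulr_gt0.
  rewrite normfV (ger0_norm (ltW h4)) invf_le1//.
  by have := hz n i ir; lra.
Qed.

Lemma null_system_exists : exists l h w, null_system U l h w.
Proof.
have [[c [lambda [c0 sep]]]|H] := pselect (exists (c : R) lambda, 0 < c /\
    forall k, separated_points c (mkseq lambda k)).
  exact: null_system_orthogonal c0 sep.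
apply: null_system_matching => c lambda c0.
apply: contrapT => H'; apply: H; exists c, lambda; split => // k.
by apply: contrapT => nsep; apply: H'; exists k.
Qed.

End null_systems.

Theorem not_montel_null_system (R : realType) (E : tvsType R) :
  frechet_space E -> ~ montel_space E ->
  exists (U : set E) l h w, nbhs 0 U /\ null_system U l h w.
Proof.
move=> frE nM; have [U [f [z [nU cU lfU fz bz]]]] := not_montel_polar frE nM.
have [V [nV cV bV]] := metrizable_base0 frE.1.
have [||l [h [w lhw]]] := @null_system_exists _ _ U f z V nU _ _ fz bz nV cV bV => //.
- by move=> n; case: (lfU n).
- by move=> n; case: (lfU n).
by exists U, l, h, w.
Qed.

(** * Bump functions with disjoint supports *)

Section disjoint_bumps.
Context {R : realType} {X : topologicalType}.

Lemma infinite_set2 (T : Type) (A : set T) : infinite_set A ->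
  exists a b, [/\ A a, A b & a <> b].
Proof.
move=> infA; apply: contrapT => H; apply: infA.
have [[a Aa]|nA] := pselect (A !=set0); last first.
  suff -> : A = set0 by exact: finite_set0.
  by rewrite -subset0 => x Ax; apply: nA; exists x.
apply: sub_finite_set (finite_set1 a) => x Ax /=.
by apply: contrapT => xa; apply: H; exists x, a.
Qed.

Lemma infinite_setI_split (T : Type) (A B C : set T) : infinite_set A ->
  A `<=` B `|` C -> infinite_set (A `&` B) \/ infinite_set (A `&` C).
Proof.
move=> infA ABC; apply: contrapT => /not_orP[/contrapT fB /contrapT fC]; apply: infA.
suff -> : A = (A `&` B) `|` (A `&` C) by rewrite finite_setU.
by rewrite -setIUr; apply/esym/setIidPl.
Qed.

Hypothesis crX : completely_regular_space X.
Hypothesis hX : hausdorff_space X.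

Lemma separating_function (a : X) (B : set X) : closed B -> ~ B a ->
  exists f : X -> R, [/\ continuous f, forall x, 0 <= f x <= 1, f a = 0 &
    forall x, B x -> f x = 1].
Proof.
move=> clB Ba; have /(@uniform_separatorP _ R)[f [cf f01 fa fB]] := crX clB Ba.
exists f; split => //.
- by move=> x; have := f01 (f x) (ex_intro2 _ _ x I erefl); rewrite /= in_itv.
- by apply: fa; exists a.
- by move=> x Bx; apply: fB; exists x.
Qed.

(** A function separating two points a and b of G and K splits K into the parts
    where it is less than 2/3 and more than 1/3; one of them is infinite.  Put
    the bump at the other end, and go on within the infinite part. *)
Lemma disjoint_bumps_step (K G : set X) : open G -> infinite_set (G `&` K) ->
  exists t (D G' : set X), [/\ K t, D t, open D, D `<=` G &
    [/\ open G', G' `<=` G, D `&` G' = set0 & infinite_set (G' `&` K)]].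
Proof.
move=> oG infGK; have [a [b [[Ga Ka] [Gb Kb] ab]]] := infinite_set2 infGK.
have clb : closed [set b] by exact/accessible_closed_set1/hausdorff_accessible.
have [f [cf _ fa fb]] := separating_function clb ab.
have {}fb : f b = 1 by exact: fb.
clear ab.
have olt (r : R) : open (G `&` [set x | f x < r]).
  by apply: openI => //; apply: open_comp (@open_lt R r) => x _; exact: cf.
have ogt (r : R) : open (G `&` [set x | r < f x]).
  by apply: openI => //; apply: open_comp (@open_gt R r) => x _; exact: cf.
have [|inf|inf] := @infinite_setI_split _ _ [set x | f x < 2 / 3] [set x | 1 / 3 < f x] infGK.
- by move=> x _ /=; have [|] := ltrP (f x) (2/3); [left|right; lra].
- exists b, (G `&` [set x | 2 / 3 < f x]), (G `&` [set x | f x < 2 / 3]).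
  split => //; first by split => //=; lra.
  split => //; last by rewrite setIAC.
  by rewrite -subset0 => x [[_ /= x1] [_ /= x2]]; lra.
- exists a, (G `&` [set x | f x < 1 / 3]), (G `&` [set x | 1 / 3 < f x]).
  split => //; first by split => //=; lra.
  split => //; last by rewrite setIAC.
  by rewrite -subset0 => x [[_ /= x1] [_ /= x2]]; lra.
Qed.

Lemma disjoint_bumps (K : set X) : infinite_set K ->
  exists (t : nat -> X) (phi : nat -> X -> R), [/\ forall k, K (t k),
    forall k, continuous (phi k), forall k x, 0 <= phi k x <= 1,
    forall k, phi k (t k) = 1 &
    forall j k x, phi j x != 0 -> phi k x != 0 -> j = k].
Proof.
move=> infK.
pose P (s : X * set X * set X) := [/\ K s.1.1, s.1.2 s.1.1, open s.1.2, open s.2 &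
  s.1.2 `&` s.2 = set0 /\ infinite_set (s.2 `&` K)].
pose step (_ : nat) (s s' : X * set X * set X) := s'.1.2 `<=` s.2 /\ s'.2 `<=` s.2.
have infTK : infinite_set (setT `&` K) by rewrite setTI.
have [t [D [G [Kt Ot oO _ [oG _ OG infG]]]]] := disjoint_bumps_step openT infTK.
have [||u Hu] := @dependent_choice_nat _ P step (t, D, G); first by split => //.
  move=> n [[t' D'] G'] [/= _ _ _ oG' [_ infG']].
  have [t1 [D1 [G1 [Kt1 Ot1 oO1 OG1 [oG1 GG1 OG11 infG1]]]]] := disjoint_bumps_step oG' infG'.
  by exists (t1, D1, G1); split.
have GG j k : (j <= k)%N -> (u k).2 `<=` (u j).2.
  elim: k => [|k IH]; first by rewrite leqn0 => /eqP ->.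
  rewrite leq_eqVlt => /predU1P[-> //|]; rewrite ltnS => /IH; apply: subset_trans.
  by have [_ []] := Hu k.
have OO j k x : (j < k)%N -> (u j).1.2 x -> (u k).1.2 x -> False.
  case: k => // k; rewrite ltnS => jk Oj Ok.
  have [_ [OG' _]] := Hu k; have := GG j k jk x (OG' x Ok).
  have [[_ _ _ _ [disj _]] _] := Hu j => Gj.
  by have : set0 x by rewrite -disj.
have /choice[psi Hpsi] : forall k, exists f : X -> R,
    [/\ continuous f, forall x, 0 <= f x <= 1, f (u k).1.1 = 0 & forall x, (~` (u k).1.2) x -> f x = 1].
  move=> k; have [[_ Ot' oO' _ _] _] := Hu k.
  by apply: separating_function; [exact: open_closedC|apply].
exists (fun k => (u k).1.1), (fun k x => 1 - psi k x).
have supp k x : 1 - psi k x != 0 -> (u k).1.2 x.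
  move=> nz; apply: contrapT => Ox; have [_ _ _ /(_ x Ox) e] := Hpsi k.
  by move: nz; rewrite e subrr eqxx.
split.
- by move=> k; have [[]] := Hu k.
- move=> k x; have [ck _ _ _] := Hpsi k.
  by apply: cvgB; [exact: cvg_cst|exact: ck].
- by move=> k x; have [_ /(_ x) + _ _] := Hpsi k; lra.
- by move=> k; have [_ _ -> _] := Hpsi k; rewrite subr0.
- move=> j k x /supp Oj /supp Ok.
  by have [lt|lt|//] := ltngtP j k; exfalso; [exact: OO lt Oj Ok|exact: OO lt Ok Oj].
Qed.

End disjoint_bumps.

(** * Retractions and function spaces *)

Section complemented_copy.
Context {R : realType}.

Lemma hausdorff_closed0 (G : tvsType R) : hausdorff_space G -> closed [set (0 : G)].
Proof. by move=> hG; exact/accessible_closed_set1/hausdorff_accessible. Qed.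

(** The projection is T Q, its range is that of T, and its kernel is that of Q. *)
Lemma complemented_copy_of_retraction (F G : tvsType R) (T : F -> G) (Q : G -> F) :
  hausdorff_space G -> linear T -> linear Q -> continuous T -> continuous Q ->
  cancel T Q -> contains_complemented_copy G F.
Proof.
move=> hG lT lQ cT cQ TK.
pose T' : {linear F -> G} := HB.pack T (GRing.isLinear.Build R F G _ T lT).
pose Q' : {linear G -> F} := HB.pack Q (GRing.isLinear.Build R G F _ Q lQ).
have cP : continuous (fun g => T (Q g)).
  by move=> g; apply: (@continuous_comp _ _ _ Q T); [exact: cQ|exact: cT].
have T0 : T 0 = 0 by exact: (linear0 T').
have Q0 : Q 0 = 0 by exact: (linear0 Q').
have TD x y : T (x + y) = T x + T y by exact: (linearD T').
have QD x y : Q (x + y) = Q x + Q y by exact: (linearD Q').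
have QB x y : Q (x - y) = Q x - Q y by exact: (linearB Q').
exists (range T), [set g | Q g = 0]; split.
- split; split.
  + by rewrite inE; exists 0.
  + move=> a u v; rewrite !inE => -[x _ <-] [y _ <-].
    by exists (a *: x + y) => //; rewrite lT.
  + by rewrite inE.
  + by move=> a u v; rewrite !inE /= lQ => -> ->; rewrite scaler0 addr0.
- split.
  + have -> : range T = (fun g => T (Q g) - g) @^-1` [set 0].
      apply/seteqP; split => [_ [x _ <-]/=|g /= /eqP]; first by rewrite TK subrr.
      by rewrite subr_eq0 => /eqP <-; exists (Q g).
    apply: preimage_closed; last exact: hausdorff_closed0.
    move=> g _; apply: (@continuous2_cvg _ _ _ _ (nbhs g) _ (fun g => T (Q g)) id
      (fun u v : G => u - v)).
    * exact: (@sub_continuous G (T (Q g), g)).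
    * exact: cP.
    * exact: cvg_id.
  + have -> : [set g | Q g = 0] = (fun g => T (Q g)) @^-1` [set 0].
      apply/seteqP; split => g /=; first by move=> ->.
      by move=> TQ0; rewrite -(TK (Q g)) TQ0.
    by apply: preimage_closed; [move=> g _; exact: cP|exact: hausdorff_closed0].
- move=> g; exists (T (Q g), g - T (Q g)); split.
    split => /=; first by exists (Q g).
      by rewrite QB TK subrr.
    by rewrite addrC subrK.
  move=> [g1 g2] /= [[x _ xg1] Qg2 ->].
  by rewrite -xg1 QD TK Qg2 addr0 addrC addKr.
- exists T', Q; split => //; exact: continuous_subspaceT.
- exists (fun g => T (Q g)) => //.
  by move=> _ y [x _ <-] /= Qy; rewrite QD TK Qy addr0.
Qed.

End complemented_copy.

Section functional_continuity.
Context {R : realType} {E : tvsType R}.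

Lemma bounded_functional_continuous (U : set E) (h : E -> R) : nbhs 0 U ->
  scalar h -> (forall x, U x -> `|h x| <= 1) -> continuous (h : E -> R^o).
Proof.
move=> nU lh hU x; apply/cvgrPdist_le => /= eps eps0.
have : nbhs x [set y | ( *:%R eps @` U) (y - x)].
  by apply: nbhs0_shift; apply: nbhs0Z => //; rewrite gt_eqF.
apply: filterS => y [v Uv vE]; rewrite -scalarB// -opprB -vE scalarN// scalarMl//.
by rewrite normrN normrM (gtr0_norm eps0) -[leRHS]mulr1 ler_pM2l// hU.
Qed.

(** Compactness in the form of near_covering, for the filter of all finite lists
    of vectors ordered by inclusion. *)
Lemma compact_finite_net (X : topologicalType) (K : set X) (g : X -> E) (U : set E) :
  compact K -> continuous g -> nbhs 0 U ->
  exists s : seq E, forall t, K t -> exists2 y, y \in s & U (g t - y).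
Proof.
move=> /compact_near_coveringP cK cg nU.
pose F := filter_from (setT : set (seq E)) (fun s => [set s' : seq E | {subset s <= s'}]).
have FF : ProperFilter F.
  apply: filter_from_proper; last by move=> s _; exists s.
  apply: filter_from_filter; first by exists [::].
  move=> s s' _ _; exists (s ++ s') => // s'' ss; split => x xs; apply: ss.
    by rewrite mem_cat xs.
  by rewrite mem_cat xs orbT.
suff /filter_ex[s Hs] : F (fun s => K `<=` (fun t => exists2 y, y \in s & U (g t - y))).
  by exists s.
apply: (cK _ F (fun (s : seq E) t => exists2 y, y \in s & U (g t - y))) => t Kt.
exists ([set t' | U (g t' - g t)], [set s : seq E | {subset [:: g t] <= s}]).
  split; first exact: (cg t _ (nbhs0_shift (g t) nU)).
  by exists [:: g t].
move=> [t' s'] /= [Ut' ss]; exists (g t) => //; apply: ss; exact: mem_head.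
Qed.

End functional_continuity.

Section function_spaces.
Context {R : realType}.

Lemma Cp_cvgP (X : topologicalType) (E : tvsType R) (F : set_system (Cp X E)) (f : Cp X E) :
  Filter F -> F --> f <-> forall t, (fun g : Cp X E => set_val g t) @ F --> set_val f t.
Proof. exact: initial_ptws_cvgP. Qed.

Lemma c0p_cvgP (F : set_system (c0p R)) (x : c0p R) :
  Filter F -> F --> x <-> forall t, (fun y : c0p R => set_val y t) @ F --> set_val x t.
Proof. exact: initial_ptws_cvgP. Qed.

Lemma Cp_eval_continuous (X : topologicalType) (E : tvsType R) t :
  continuous (fun g : Cp X E => set_val g t).
Proof. by move=> f; exact: (iffLR (@Cp_cvgP _ _ (nbhs f) f _) cvg_id). Qed.

Lemma c0p_eval_continuous n : continuous (fun x : c0p R => set_val x n).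
Proof. by move=> x; exact: (iffLR (@c0p_cvgP (nbhs x) x _) cvg_id). Qed.

Lemma Cp_hausdorff (X : topologicalType) (E : tvsType R) : hausdorff_space E ->
  hausdorff_space (Cp X E).
Proof.
move=> hE p q pq; apply/val_inj/funext => t; apply: hE => A B nA nB.
have [g [Ag Bg]] := pq _ _ (@Cp_eval_continuous X E t p A nA)
  (@Cp_eval_continuous X E t q B nB).
by exists (set_val g t).
Qed.

End function_spaces.

(** * The retraction of the function space *)

Section assembly.
Context {R : realType} {X : topologicalType} {E : tvsType R}.
Variables (U : set E) (l : nat -> nat) (h : nat -> nat -> E -> R) (w : nat -> nat -> E).
Hypothesis nU : nbhs 0 U.
Hypothesis lhw : null_system U l h w.
Variables (K : set X) (t : nat -> X) (phi : nat -> X -> R).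
Hypothesis cK : compact K.
Hypothesis Kt : forall k, K (t k).
Hypothesis cphi : forall k, continuous (phi k).
Hypothesis phi01 : forall k x, 0 <= phi k x <= 1.
Hypothesis phit : forall k, phi k (t k) = 1.
Hypothesis disj : forall j k x, phi j x != 0 -> phi k x != 0 -> j = k.

Let pt (n i : nat) : X := t (pickle (n, i)).
Let bump (p : nat * nat) : X -> R := phi (pickle p).

Lemma null_system_null x (eps : R) : 0 < eps -> exists N, forall n, (N <= n)%N ->
  \sum_(i < l n) `|h n i x| <= (l n)%:R * eps.
Proof.
move=> eps0; have [_ hl h0 _ _] := lhw.
have [r r0 Ux] := nbhs0_absorbs x nU.
have [|N HN] := h0 _ Ux (eps / r); first exact: divr_gt0.
exists N => n Nn; have := HN n Nn.
rewrite -(ler_pM2l r0) mulr_sumr.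
rewrite (_ : r * _ = (l n)%:R * eps); last by field; rewrite gt_eqF.
congr (_ <= _); apply: eq_bigr => i _; have [lh _] := hl n i (ltn_ord i).
by rewrite scalarMl// normrM normfV (gtr0_norm r0) mulrA divff ?mul1r// gt_eqF.
Qed.

Lemma null_system_null_seq (s : seq E) (eps : R) : 0 < eps ->
  exists N, forall n, (N <= n)%N ->
  \sum_(i < l n) \sum_(y <- s) `|h n i y| <= (l n)%:R * eps.
Proof.
elim: s eps => [|y s IH] eps eps0.
  by exists 0%N => n _; rewrite big1 ?mulr_ge0 ?(ltW eps0)// => i _; rewrite big_nil.
have e2 : 0 < eps / 2 by exact: divr_gt0.
have [N HN] := IH _ e2; have [N' HN'] := null_system_null y e2.
exists (maxn N N') => n; rewrite geq_max => /andP[/HN Hn /HN' Hn'].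
under eq_bigr => i _ do rewrite big_cons.
rewrite big_split/=; apply: le_trans (lerD Hn' Hn) _.
by rewrite -mulrDr -splitr.
Qed.

Definition coefficients (g : X -> E) (n : nat) : R^o :=
  (l n)%:R^-1 * \sum_(i < l n) h n i (g (pt n i)).

(** Replace g(t_(n,i)) by a nearby point y of a finite net of g(K): the error is
    small because h_(n,i) is bounded on U, and as i varies the sum over the net
    of the |h_(n,i)(y)| is small in the mean. *)
Lemma coefficients_cvg0 g : continuous g ->
  coefficients g n @[n --> \oo] --> (0 : R^o).
Proof.
move=> cg; have [l0 hl _ _ _] := lhw.
apply/cvgrPdist_le => /= eps eps0.
have e2 : 0 < eps / 2 by exact: divr_gt0.
have [|s Hs] := @compact_finite_net _ _ _ _ g ( *:%R (eps / 2) @` U) cK cg.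
  by apply: nbhs0Z => //; rewrite gt_eqF.
have [N HN] := null_system_null_seq s e2.
exists N => // n /= Nn; rewrite sub0r normrN /coefficients.
have ln0 : 0 < (l n)%:R :> R by rewrite ltr0n.
rewrite normrM normfV (gtr0_norm ln0) mulrC ler_pdivrMr//.
apply: le_trans (ler_norm_sum _ _ _) _.
apply: (@le_trans _ _ (\sum_(i < l n) (eps / 2 + \sum_(y <- s) `|h n i y|))); last first.
  rewrite big_split/= sumr_const card_ord -[X in X + _]mulr_natr.
  by apply: le_trans (lerD (lexx _) (HN n Nn)) _; rewrite mulrC -mulrDr -splitr mulrC.
apply: ler_sum => i _; have [lh hU] := hl n i (ltn_ord i).
have [y ys [v Uv vE]] := Hs _ (Kt (pickle (n, i : nat))).
have -> : g (pt n i) = (eps / 2) *: v + y by rewrite vE subrK.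
rewrite scalarD// scalarMl//; apply: le_trans (ler_normD _ _) _; apply: lerD.
  by rewrite normrM (gtr0_norm e2) -[leRHS]mulr1 ler_pM2l// hU.
by rewrite (big_rem y)//= lerDl; apply: sumr_ge0.
Qed.

Definition to_c0p (g : Cp X E) : c0p R :=
  @SigSub _ _ _ (coefficients (set_val g))
    (@mem_set _ [set x : nat -> R^o | x n @[n --> \oo] --> (0 : R^o)] _
      (coefficients_cvg0 (set_mem (valP g)))).

Lemma to_c0p_linear : linear to_c0p.
Proof.
move=> a f g; apply/val_inj/funext => n /=.
have [_ hl _ _ _] := lhw.
rewrite /coefficients /=.
rewrite -[RHS]/(a * _ + _) mulrCA -mulrDr; congr (_ * _).
rewrite mulr_sumr -big_split/=; apply: eq_bigr => i _.
by have [lh _] := hl n i (ltn_ord i); exact: lh.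
Qed.

Lemma to_c0p_continuous : continuous to_c0p.
Proof.
move=> f; apply: (iffRL (@c0p_cvgP R (to_c0p @ nbhs f) (to_c0p f) _)) => n /=.
have [_ hl _ _ _] := lhw.
rewrite /coefficients.
apply: (@cvgMl_tmp R (Cp X E) (nbhs f) _
  (fun g : Cp X E => \sum_(i < l n) h n i (set_val g (pt n i)) : R)).
apply: (@cvg_big R^o 'I_(l n) +%R 0 xpredT (@add_continuous R^o) (Cp X E) (nbhs f) _
  (fun i g => h n i (set_val g (pt n i)))).
move=> i _; have [lh hU] := hl n i (ltn_ord i).
apply: (@continuous_comp (Cp X E) E R^o (fun g : Cp X E => set_val g (pt n i)) (h n i)).
  exact: Cp_eval_continuous.
exact: (bounded_functional_continuous nU lh hU).
Qed.

Lemma active_bump_exists : exists act : X -> nat * nat, forall x p, bump p x != 0 -> p = act x.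
Proof.
have /choice[act Hact] : forall x, exists q, forall p, bump p x != 0 -> p = q.
  move=> x; have [[q qx]|none] := pselect (exists q, bump q x != 0); last first.
    by exists (0, 0)%N => p px; exfalso; apply: none; exists p.
  exists q => p px; apply: (pcan_inj pickleK); exact: disj px qx.
by exists act.
Qed.

Definition truncated_w (p : nat * nat) : E := if (p.2 < l p.1)%N then w p.1 p.2 else 0.

Variable act : X -> nat * nat.
Hypothesis Hact : forall x p, bump p x != 0 -> p = act x.

(** The sum of all a n * bump (n, i) x *: w n i, which has at most one nonzero
    term; act x is the index of that term, if there is one. *)
Definition bump_sum (a : nat -> R) (x : X) : E :=
  (a (act x).1 * bump (act x) x) *: truncated_w (act x).

Lemma bump_continuous p (a : R) (y : E) : continuous (fun x => (a * bump p x) *: y).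
Proof.
move=> x; apply: (@continuous2_cvg _ _ _ _ (nbhs x) _ (fun x => a * bump p x : R^o) (cst y)
  (fun (u : R^o) (v : E) => u *: v)).
- exact: (@scale_continuous R E (a * bump p x, y)).
- by apply: cvgMl_tmp; exact: cphi.
- exact: cvg_cst.
Qed.

(** Where a bump is active it is the only one nearby.  At a point where all bumps
    vanish, finitely many of them are small by continuity, and the remaining
    ones carry vectors that are small since a tends to 0. *)
Lemma bump_sum_continuous (a : nat -> R) : a n @[n --> \oo] --> (0 : R) ->
  continuous (bump_sum a).
Proof.
move=> a0 x0; have [_ _ _ _ bw] := lhw.
have [[p px]|none] := pselect (exists p, bump p x0 != 0).
  have pE := Hact px.
  have near_p : \forall x \near x0, bump p x != 0.
    have : bump p x @[x --> x0] --> bump p x0 by exact: cphi.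
    by move=> /cvgr_neq0; apply.
  have : (a p.1 * bump p x) *: truncated_w p @[x --> x0] --> bump_sum a x0.
    by rewrite /bump_sum -pE; exact: bump_continuous.
  apply: cvg_trans; apply: near_eq_cvg; near=> x; rewrite /bump_sum.
  have -> : act x = p by apply/esym/Hact; near: x.
  by [].
have b0 p : bump p x0 = 0.
  by apply/eqP; apply: contrapT => /negP px; apply: none; exists p.
rewrite /continuous_at; have -> : bump_sum a x0 = 0 by rewrite /bump_sum b0 mulr0 scale0r.
move=> A /nbhs0_abs_convex[W [nW cW WA]].
have [r [N [r0 Hr]]] := bw W nW.
have [N' _ HN'] : \forall n \near \oo, `|a n| <= r^-1.
  by move/cvgr0Pnorm_le : a0; apply; rewrite invr_gt0.
have : \forall x \near x0, forall n : 'I_(maxn N N'), forall i : 'I_(l n),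
    W ((a n * bump (n : nat, i : nat) x) *: w n i).
  apply: filter_forall => n; apply: filter_forall => i.
  have : (fun x => (a n * bump (n : nat, i : nat) x) *: w n i) @ x0 --> (0 : E).
    rewrite -(scale0r (w n i)) -(mulr0 (a n)) -(b0 (n : nat, i : nat)).
    exact: bump_continuous.
  exact.
apply: filterS => x Hx; apply: WA; rewrite /bump_sum /truncated_w.
move: (act x) => [n i] /=.
case: ifPn => il; last by rewrite scaler0; exact: nbhs_singleton.
have [nN|] := ltnP n (maxn N N'); first exact: (Hx (Ordinal nN) (Ordinal il)).
rewrite geq_max => /andP[Nn N'n].
have -> : (a n * bump (n, i) x) *: w n i = (a n * bump (n, i) x * r) *: (r^-1 *: w n i).
  by rewrite scalerA mulfK// gt_eqF.
apply: abs_convex_balanced => //; first exact: Hr.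
have := phi01 (pickle (n, i)) x => /andP[p0 p1].
rewrite !normrM (gtr0_norm r0) -ler_pdivlMr// mul1r (ger0_norm p0).
apply: le_trans (HN' n N'n); exact: ler_piMr.
Unshelve. all: by end_near. Qed.

Definition of_c0p (a : c0p R) : Cp X E :=
  @SigSub _ _ _ (bump_sum (set_val a))
    (@mem_set _ [set f : X -> E | continuous f] _ (bump_sum_continuous (set_mem (valP a)))).

Lemma of_c0p_linear : linear of_c0p.
Proof.
move=> c a b; apply/val_inj/funext => x.
rewrite -[RHS]/(c *: bump_sum (set_val a) x + bump_sum (set_val b) x).
rewrite -[LHS]/(bump_sum (set_val (c *: a + b)) x) /bump_sum scalerA -scalerDl.
by congr (_ *: _); rewrite mulrA -mulrDl.
Qed.

Lemma of_c0p_continuous : continuous of_c0p.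
Proof.
move=> a; apply: (iffRL (@Cp_cvgP R X E (of_c0p @ nbhs a) (of_c0p a) _)) => x.
apply: (@continuous2_cvg _ _ _ _ (nbhs a) _
  (fun b : c0p R => set_val b (act x).1 * bump (act x) x : R^o)
  (cst (truncated_w (act x))) (fun (u : R^o) (v : E) => u *: v)).
- exact: (@scale_continuous R E (_, _)).
- by apply: cvgMr_tmp; exact: c0p_eval_continuous.
- exact: cvg_cst.
Qed.

Lemma of_c0pK : cancel of_c0p to_c0p.
Proof.
move=> a; apply/val_inj/funext => n; have [l0 hl _ hw _] := lhw.
rewrite -[LHS]/(coefficients (bump_sum (set_val a)) n) /coefficients.
rewrite (eq_bigr (fun=> set_val a n)).
  rewrite sumr_const card_ord -[X in _ * X]mulr_natr mulrCA mulVf ?mulr1//.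
  by rewrite pnatr_eq0 -lt0n.
move=> i _; have [lh _] := hl n i (ltn_ord i).
have b1 : bump (n, i : nat) (pt n i) = 1 by exact: phit.
rewrite /bump_sum; have <- : (n, i : nat) = act (pt n i) by apply: Hact; rewrite b1 oner_neq0.
by rewrite b1 mulr1 /truncated_w /= ltn_ord scalarMl// hw// mulr1.
Qed.

End assembly.

Theorem corollary6p4 (R : realType) (X : topologicalType) (E : tvsType R) :
  tychonoff_space X ->
  (exists K : set X, compact K /\ infinite_set K) ->
  frechet_space E ->
  ~ montel_space E ->
  contains_complemented_copy (Cp X E) (c0p R).
Proof.
move=> [crX hX] [K [cK infK]] frE nM.
have [U [l [h [w [nU lhw]]]]] := not_montel_null_system frE nM.
have [t [phi [Kt cphi phi01 phit disj]]] := @disjoint_bumps R X crX hX K infK.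
have [act Hact] := active_bump_exists disj.
apply: (complemented_copy_of_retraction (T := of_c0p lhw cphi phi01 Hact)
  (Q := to_c0p nU lhw cK Kt)).
- exact/Cp_hausdorff/metrizable_hausdorff/frE.1.
- exact: of_c0p_linear.
- exact: to_c0p_linear.
- exact: of_c0p_continuous.
- exact: to_c0p_continuous.
- exact: of_c0pK.
Qed.
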